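(* Let $M,N$ be positive integers and let $$V_1=\exp\Big(\sum_{i,j\in\{1,\dots,M,a\}}\sum_{m,n\ge0}A^{ij}_{mn}\psi^i_{m+1/2}\psi^{j*}_{-n-1/2}\Big)|0\rangle\in\mathcal F_1\otimes\cdots\otimes\mathcal F_M\otimes\mathcal F_a,$$ $$V_2=\exp\Big(\sum_{i,j\in\{b,M+1,\dots,M+N\}}\sum_{m,n\ge0}A^{ij}_{mn}\psi^i_{m+1/2}\psi^{j*}_{-n-1/2}\Big)|0\rangle\in\mathcal F_{M+1}\otimes\cdots\otimes\mathcal F_{M+N}\otimes\mathcal F_b$$ be two Bogoliubov transforms. Let $\mathbf E=\{E^{ij}_{mn}:m,n\ge0,\ i,j\in\{a,b\}\}$ be arbitrary coefficients (possibly with parameters). Then the normalized gluing $G^{\mathbf E}(V_1,V_2)$ of $V_1$ and $V_2$ with respect to the gluing vector $P^{\mathbf E}_{ab}$ (both defined in the context) is a Bogoliubov transform in $\mathcal F_1\otimes\cdots\otimes\mathcal F_{M+N}$; that is, it equals $\exp\big(\sum_{i,j=1}^{M+N}\sum_{m,n\ge0}R^{ij}_{mn}\psi^i_{m+1/2}\psi^{j*}_{-n-1/2}\big)|0\rangle$ for some coefficients $R^{ij}_{mn}$ (formal power series in $Q,\Theta,\Theta^{-1}$).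
   Context: Fermionic Fock space. A set $A=\{a_1>a_2>\cdots\}\subset\mathbb Z+\frac12$ is admissible if both $\{r\in\mathbb Z+\frac12: r<0\}\setminus A$ and $A\setminus\{r\in\mathbb Z+\frac12: r<0\}$ are finite. $\mathcal F$ is the vector space with orthonormal basis (for a bilinear inner product) the semi-infinite wedges $\underline A=\underline{a_1}\wedge\underline{a_2}\wedge\cdots$, $A$ admissible. The vacuum is $|0\rangle=\underline{-\frac12}\wedge\underline{-\frac32}\wedge\cdots$. For $r\in\mathbb Z+\frac12$: $\psi_r(\underline A)=(-1)^k\,\underline{a_1}\wedge\cdots\wedge\underline{a_k}\wedge\underline r\wedge\underline{a_{k+1}}\wedge\cdots$ if $a_k>r>a_{k+1}$ (with $k=0$ if $r>a_1$), and $0$ if $r\in A$; $\psi_r^*(\underline A)=(-1)^{k+1}\,\underline{a_1}\wedge\cdots\wedge\widehat{\underline{a_k}}\wedge\cdots$ if $a_k=r$, and $0$ if $r\notin A$. Then $\psi_r,\psi_r^*$ are adjoint, $\psi_r\psi_s^*+\psi_s^*\psi_r=\delta_{rs}$, and all other anticommutators vanish. Multi-component version. $\mathcal F_i$ are copies of $\mathcal F$ labelled by indices $i$. On a tensor product of several $\mathcal F_i$, $\psi^i_r,\psi^{i*}_r$ act on the $i$-th factor as $\psi_r,\psi_r^*$, with the Koszul sign convention, so that operators with different upper indices anticommute. $|0\rangle$ denotes the tensor product of the vacua; the tensor product carries the induced inner product. Bogoliubov transform. A vector of the form $\exp(\sum_{i,j}\sum_{m,n\ge0}A^{ij}_{mn}\psi^i_{m+1/2}\psi^{j*}_{-n-1/2})|0\rangle$,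 where $i,j$ run over the indices of the tensor factors and $A^{ij}_{mn}$ are arbitrary coefficients, possibly depending on parameters (i.e. lying in a commutative ring containing $\mathbb Q$). Infinite sums of basis vectors are allowed and understood formally. Gluing vector. $P^{\mathbf E}_{ab}=\exp\big(\sum_{i,j\in\{a,b\}}\sum_{m,n\ge0}Q^{m+n+1}\Theta^{\epsilon_{ij}}E^{ij}_{mn}\psi^i_{m+1/2}\psi^{j*}_{-n-1/2}\big)|0\rangle\in\mathcal F_a\otimes\mathcal F_b$, where $Q,\Theta$ are formal variables and $\epsilon_{ab}=1$, $\epsilon_{ba}=-1$, $\epsilon_{aa}=\epsilon_{bb}=0$. Gluing. The tensor product $V_1\otimes V_2$ is the Bogoliubov transform $V=\exp\big(\sum_{i,j\in\{a,b,1,\dots,M+N\}}\sum_{m,n\ge0}A^{ij}_{mn}\psi^i_{m+1/2}\psi^{j*}_{-n-1/2}\big)|0\rangle$ in $\mathcal F_1\otimes\cdots\otimes\mathcal F_{M+N}\otimes\mathcal F_a\otimes\mathcal F_b$, where $A^{ij}_{mn}=0$ if $i,j$ do not both lie in $\{a,1,\dots,M\}$ or both in $\{b,M+1,\dots,M+N\}$. Put $\tilde G^{\mathbf E}(V_1,V_2)=(V,P^{\mathbf E}_{ab})$ (inner product over the components $\mathcal F_a\otimes\mathcal F_b$), $\tilde G^{\mathbf E}(V_1,V_2)_{closed}=\big(\exp(\sum_{i,j\in\{a,b\}}\sum_{m,n\ge0}A^{ij}_{mn}\psi^i_{m+1/2}\psi^{j*}_{-n-1/2})|0\rangle_{ab},P^{\mathbf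 E}_{ab}\big)$ with $|0\rangle_{ab}$ the vacuum of $\mathcal F_a\otimes\mathcal F_b$, and $G^{\mathbf E}(V_1,V_2)=\tilde G^{\mathbf E}(V_1,V_2)/\tilde G^{\mathbf E}(V_1,V_2)_{closed}$, the normalized gluing. These are viewed as formal power series in $Q,\Theta,\Theta^{-1}$; the closed part has $Q^0$-coefficient $1$, so the quotient makes sense. *)

(* Defs.v *)
From HB Require Import structures.
From mathcomp Require Import all_boot all_order all_algebra.
From mathcomp Require Import finmap boolp classical_sets functions cardinality.
From mathcomp Require Import fsbigop zify.

Set Implicit Arguments.
Unset Strict Implicit.
Unset Printing Implicit Defensive.

Import Order.TTheory GRing.Theory Num.Theory.

Local Open Scope classical_set_scope.
Local Open Scope ring_scope.

(* [\sum_(x \in [set: T]) F x] is the sum over the support of F when this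
   support is finite, and 0 otherwise.  It is only used below for families with
   finite support. *)

(* The formal power series ring A[[Q]]. *)
Record fps (A : Type) := Fps { fps_coef : nat -> A }.

HB.instance Definition _ (A : Type) := gen_eqMixin (fps A).
HB.instance Definition _ (A : Type) := gen_choiceMixin (fps A).

Lemma fpsP (A : Type) (f g : fps A) :
  (forall k, fps_coef f k = fps_coef g k) -> f = g.
Proof. by case: f g => [f] [g] /= /funext ->. Qed.

Section FpsZmod.
Variable A : zmodType.
Implicit Types f g : fps A.

Definition fps_zero : fps A := Fps (fun=> 0).
Definition fps_opp f : fps A := Fps (fun k => - fps_coef f k).
Definition fps_add f g : fps A := Fps (fun k => fps_coef f k + fps_coef g k).

Lemma fps_addA : associative fps_add.
Proof. by move=> f g h; apply: fpsP => k /=; rewrite addrA. Qed.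
Lemma fps_addC : commutative fps_add.
Proof. by move=> f g; apply: fpsP => k /=; rewrite addrC. Qed.
Lemma fps_add0 : left_id fps_zero fps_add.
Proof. by move=> f; apply: fpsP => k /=; rewrite add0r. Qed.
Lemma fps_addN : left_inverse fps_zero fps_opp fps_add.
Proof. by move=> f; apply: fpsP => k /=; rewrite addNr. Qed.

HB.instance Definition _ :=
  GRing.isZmodule.Build (fps A) fps_addA fps_addC fps_add0 fps_addN.

End FpsZmod.

Section FpsRing.
Variable A : comNzRingType.
Implicit Types f g : fps A.

Definition fps_one : fps A := Fps (fun k => (k == 0%N)%:R).
Definition fps_mul f g : fps A :=
  Fps (fun k => \sum_(i < k.+1) fps_coef f i * fps_coef g (k - i)).

Let trunc n f : {poly A} := \poly_(i < n) fps_coef f i.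

Let coef_trunc n f k : (k < n)%N -> (trunc n f)`_k = fps_coef f k.
Proof. by move=> kn; rewrite coef_poly kn. Qed.

Let fps_mulE n f g k : (k < n)%N ->
  fps_coef (fps_mul f g) k = (trunc n f * trunc n g)`_k.
Proof.
move=> kn; rewrite coefM; apply: eq_bigr => i _.
by rewrite !coef_trunc// (leq_ltn_trans _ kn)// ?leq_subr// -ltnS.
Qed.

Lemma fps_mulC : commutative fps_mul.
Proof. by move=> f g; apply: fpsP => k; rewrite !(@fps_mulE k.+1)// mulrC. Qed.

Lemma fps_mulA : associative fps_mul.
Proof.
move=> f g h; apply: fpsP => k.
transitivity ((trunc k.+1 f * trunc k.+1 g * trunc k.+1 h)`_k).
  rewrite -mulrA coefM; apply: eq_bigr => i _.
  by rewrite coef_trunc// (@fps_mulE k.+1)// ltnS leq_subr.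
rewrite coefM; apply: eq_bigr => i _.
by rewrite coef_trunc ?ltnS ?leq_subr// (@fps_mulE k.+1).
Qed.

Lemma fps_mul1 : left_id fps_one fps_mul.
Proof.
move=> f; apply: fpsP => k /=.
rewrite big_ord_recl /= mul1r subn0 big1 ?addr0// => i _.
by rewrite mul0r.
Qed.

Lemma fps_mulDl : left_distributive fps_mul +%R.
Proof.
move=> f g h; apply: fpsP => k /=; rewrite -big_split /=.
by apply: eq_bigr => i _; rewrite mulrDl.
Qed.

Lemma fps_one_neq0 : fps_one != 0.
Proof.
by apply/eqP => /(congr1 (fun f => fps_coef f 0)) /= /eqP; rewrite oner_eq0.
Qed.

HB.instance Definition _ := GRing.Zmodule_isComNzRing.Build (fps A)
  fps_mulA fps_mulC fps_mul1 fps_mulDl fps_one_neq0.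

Definition fps_unit : {pred fps A} := fun f => `[< exists g, g * f = 1 >].
Definition fps_inv f : fps A := xget f [set g | g * f = 1].

Lemma fps_mulVx : {in fps_unit, left_inverse 1 fps_inv *%R}.
Proof. by move=> f /asboolP[g gf1]; rewrite /fps_inv; case: xgetP => // /(_ g). Qed.
Lemma fps_unitPl f g : g * f = 1 -> fps_unit f.
Proof. by move=> gf1; apply/asboolP; exists g. Qed.
Lemma fps_inv_out : {in [predC fps_unit], fps_inv =1 id}.
Proof.
move=> f; rewrite inE => /asboolP nuf; rewrite /fps_inv.
by case: xgetP => // g _ gf1; case: nuf; exists g.
Qed.

HB.instance Definition _ := GRing.ComNzRing_hasMulInverse.Build (fps A)
  fps_mulVx fps_unitPl fps_inv_out.

Lemma fps_coefM f g k :
  fps_coef (f * g) k = \sum_(i < k.+1) fps_coef f i * fps_coef g (k - i).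
Proof. by []. Qed.

(* So [h / f] is a genuine quotient when f has constant term 1. *)
Lemma fps_unit_coef0 f : fps_coef f 0 = 1 -> f \is a GRing.unit.
Proof.
move=> f0; pose u := 1 - f.
have fu : f = 1 - u by rewrite opprB addrC subrK.
have u0 n k : (k < n)%N -> fps_coef (u ^+ n) k = 0.
  elim: n k => // n IHn k kn; rewrite exprS fps_coefM big_ord_recl /= f0 subrr.
  rewrite mul0r add0r big1 // => i _; rewrite IHn ?mulr0//.
  by rewrite /bump /= add1n -ltnS (leq_ltn_trans _ kn)// ltn_subrL ltn0Sn /=
    (leq_ltn_trans _ (ltn_ord i)).
pose s n : fps A := \sum_(i < n) u ^+ i.
have fs n : s n * f = 1 - u ^+ n.
  by rewrite -opprB subrX1 -mulNr opprB -fu mulrC.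
have ss n k : (k < n)%N -> fps_coef (s n) k = fps_coef (s k.+1) k.
  elim: n => // n IHn; rewrite ltnS leq_eqVlt => /orP[/eqP ->//|kn].
  by rewrite {1}/s big_ord_recr /= u0// addr0 IHn.
apply/asboolP; exists (Fps (fun k => fps_coef (s k.+1) k)).
apply: fpsP => k; rewrite fps_coefM /=.
under eq_bigr => i _ do rewrite -(@ss k.+1 i)//.
by rewrite -fps_coefM fs /= u0 ?subr0.
Qed.

End FpsRing.

Section FpsAlg.
Variables (B : comNzRingType) (A : comAlgType B).
Implicit Types f g : fps A.

Definition fps_scale (c : B) f : fps A := Fps (fun k => c *: fps_coef f k).

Lemma fps_scaleA a b f : fps_scale a (fps_scale b f) = fps_scale (a * b) f.
Proof. by apply: fpsP => k /=; rewrite scalerA. Qed.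
Lemma fps_scale1 : left_id 1 fps_scale.
Proof. by move=> f; apply: fpsP => k /=; rewrite scale1r. Qed.
Lemma fps_scaleDr : right_distributive fps_scale +%R.
Proof. by move=> a f g; apply: fpsP => k /=; rewrite scalerDr. Qed.
Lemma fps_scaleDl f : {morph fps_scale^~ f : a b / a + b}.
Proof. by move=> a b; apply: fpsP => k /=; rewrite scalerDl. Qed.

HB.instance Definition _ := GRing.Zmodule_isLmodule.Build B (fps A)
  fps_scaleA fps_scale1 fps_scaleDr fps_scaleDl.

Lemma fps_scaleAl (a : B) f g : a *: (f * g) = (a *: f) * g.
Proof.
apply: fpsP => k /=; rewrite scaler_sumr.
by apply: eq_bigr => i _; rewrite scalerAl.
Qed.

HB.instance Definition _ := GRing.Lmodule_isLalgebra.Build B (fps A) fps_scaleAl.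
HB.instance Definition _ := GRing.Lalgebra_isComAlgebra.Build B (fps A).

End FpsAlg.

(* The ring of Laurent polynomials A[Theta, Theta^-1]. *)
Record laurent (A : nmodType) := Laurent {
  laurent_coef : int -> A;
  laurent_bound : exists n : nat, forall l : int,
    (n < `|l|)%N -> laurent_coef l = 0 }.

HB.instance Definition _ (A : nmodType) := gen_eqMixin (laurent A).
HB.instance Definition _ (A : nmodType) := gen_choiceMixin (laurent A).

Lemma laurentP (A : nmodType) (f g : laurent A) :
  (forall l, laurent_coef f l = laurent_coef g l) -> f = g.
Proof.
case: f g => [f fb] [g gb] /= /funext fg; rewrite fg in fb *.
by rewrite (Prop_irrelevance fb gb).
Qed.

Section LaurentZmod.
Variable A : zmodType.
Implicit Types f g : laurent A.

Lemma laurent_zero_bound : exists n : nat, forall l : int,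
  (n < `|l|)%N -> (fun=> 0) l = 0 :> A.
Proof. by exists 0%N. Qed.
Definition laurent_zero : laurent A := Laurent laurent_zero_bound.

Lemma laurent_opp_bound f : exists n : nat, forall l : int,
  (n < `|l|)%N -> (fun k => - laurent_coef f k) l = 0.
Proof. by case: (laurent_bound f) => n fn; exists n => l /fn ->; rewrite oppr0. Qed.
Definition laurent_opp f : laurent A := Laurent (laurent_opp_bound f).

Lemma laurent_add_bound f g : exists n : nat, forall l : int,
  (n < `|l|)%N -> (fun k => laurent_coef f k + laurent_coef g k) l = 0.
Proof.
case: (laurent_bound f) (laurent_bound g) => [n fn] [m gm].
exists (maxn n m) => l; rewrite gtn_max => /andP[/fn -> /gm ->].
by rewrite addr0.
Qed.
Definition laurent_add f g : laurent A := Laurent (laurent_add_bound f g).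

Lemma laurent_addA : associative laurent_add.
Proof. by move=> f g h; apply: laurentP => k /=; rewrite addrA. Qed.
Lemma laurent_addC : commutative laurent_add.
Proof. by move=> f g; apply: laurentP => k /=; rewrite addrC. Qed.
Lemma laurent_add0 : left_id laurent_zero laurent_add.
Proof. by move=> f; apply: laurentP => k /=; rewrite add0r. Qed.
Lemma laurent_addN : left_inverse laurent_zero laurent_opp laurent_add.
Proof. by move=> f; apply: laurentP => k /=; rewrite addNr. Qed.

HB.instance Definition _ := GRing.isZmodule.Build (laurent A)
  laurent_addA laurent_addC laurent_add0 laurent_addN.

Lemma laurent_mono_bound (l0 : int) (c : A) : exists n : nat, forall l : int,
  (n < `|l|)%N -> (fun k => if k == l0 then c else 0) l = 0.
Proof. by exists `|l0|%N => l; case: eqVneq => // ->; rewrite ltnn. Qed.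

(* c Theta^l0 *)
Definition laurent_mono (l0 : int) (c : A) : laurent A :=
  Laurent (laurent_mono_bound l0 c).

End LaurentZmod.

Section LaurentRing.
Variable A : comNzRingType.
Implicit Types (f g h : laurent A) (F G : int -> A) (p q : {poly A}).

Definition laurent_one : laurent A := laurent_mono 0 1.

Let conv F G (l : int) : A := \sum_(k \in [set: int]) F k * G (l - k).

(* [rep F n p] : F is the coefficient sequence of Theta^-n p *)
Let rep F (n : nat) p :=
  forall l : int, F l = if l + n%:Z is Posz k then p`_k else 0.

Let rep_bound F n p : rep F n p ->
  exists m : nat, forall l : int, (m < `|l|)%N -> F l = 0.
Proof.
move=> Fp; exists (n + size p)%N => l nl; rewrite Fp.
case E: (l + n%:Z) => [k|//]; apply: nth_default; move: nl E; set t := size p. lia.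
Qed.

Let bound_rep F m n : (forall l : int, (m < `|l|)%N -> F l = 0) -> (m <= n)%N ->
  exists p, rep F n p.
Proof.
move=> F0 mn; exists (\poly_(i < (n + n).+1) F (i%:Z - n%:Z)) => l.
case E: (l + n%:Z) => [k|k]; last by apply: F0; lia.
rewrite coef_poly; case: ltnP => [_|kn]; last by apply: F0; lia.
by rewrite -E addrK.
Qed.

Let repP f : exists n p, rep (laurent_coef f) n p.
Proof.
have [n fn] := laurent_bound f; have [p fp] := bound_rep fn (leqnn n).
by exists n, p.
Qed.

Let rep_conv F G n m p q : rep F n p -> rep G m q ->
  rep (conv F G) (n + m) (p * q).
Proof.
move=> Fp Gq l; rewrite /conv.
pose N := (size p + `|(l + n%:Z + m%:Z)%R|.+1)%N.
pose r := [seq i%:Z - n%:Z | i <- iota 0 N].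
have r_uniq : uniq r.
  by rewrite map_inj_uniq ?iota_uniq// => i j /addIr [].
rewrite (fsbigE r)//; last first.
  move=> k _ kr; rewrite Fp; case E: (k + n%:Z) => [j|j]; last by rewrite mul0r.
  rewrite nth_default ?mul0r// leqNgt; apply: contra kr => js.
  apply/mapP; exists j; last by rewrite -E addrK.
  by rewrite mem_iota /N /= add0n (leq_trans js)// leq_addr.
rewrite big_map; have -> : iota 0 N = index_iota 0 N by rewrite /index_iota subn0.
rewrite big_mkord (eq_bigr (fun i : 'I_N =>
    p`_i * if l + (n + m)%:Z - i%:Z is Posz k then q`_k else 0)); last first.
  move=> i _; rewrite Fp Gq subrK.
  by congr (_ * _); rewrite (_ : l - _ + _ = l + (n + m)%:Z - i%:Z) //; lia.
rewrite (eq_bigl predT) => [|i]; last by rewrite in_setT.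
case E: (l + (n + m)%:Z) => [L|L]; last first.
  rewrite big1 // => i _; case E' : (_ - _) => [k|k]; last by rewrite mulr0.
  by exfalso; lia.
rewrite coefM.
have LN : (L.+1 <= N)%N by rewrite /N; lia.
rewrite (big_ord_widen N (fun i => p`_i * q`_(L - i)) LN) [RHS]big_mkcond /=.
apply: eq_bigr => i _; case: ltnP => iL.
  by rewrite (_ : L%:Z - i%:Z = (L - i)%N%:Z) //; lia.
by case E' : (_ - _) => [k|k]; [exfalso; lia|rewrite mulr0].
Qed.

Let rep_eq F G n p : rep F n p -> rep G n p -> F = G.
Proof. by move=> Fp Gp; apply/funext => l; rewrite Fp Gp. Qed.

Lemma laurent_mul_bound f g : exists n : nat, forall l : int, (n < `|l|)%N ->
  (fun l => \sum_(k \in [set: int]) laurent_coef f k * laurent_coef g (l - k)) l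
    = 0.
Proof.
have [n [p fp]] := repP f; have [m [q gq]] := repP g.
exact: rep_bound (rep_conv fp gq).
Qed.
Definition laurent_mul f g : laurent A := Laurent (laurent_mul_bound f g).

Let laurent_eq f g : laurent_coef f = laurent_coef g -> f = g.
Proof. by move=> fg; apply: laurentP => l; rewrite fg. Qed.

Lemma laurent_mulC : commutative laurent_mul.
Proof.
move=> f g; have [n [p fp]] := repP f; have [m [q gq]] := repP g.
apply: laurent_eq; apply: (rep_eq (rep_conv fp gq)).
by rewrite addnC mulrC; exact: rep_conv.
Qed.

Lemma laurent_mulA : associative laurent_mul.
Proof.
move=> f g h; have [n [p fp]] := repP f; have [m [q gq]] := repP g.
have [o [r hr]] := repP h; apply: laurent_eq.
apply: (rep_eq (rep_conv fp (rep_conv gq hr))).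
by rewrite addnA mulrA; exact: rep_conv (rep_conv fp gq) hr.
Qed.

Lemma laurent_mul1 : left_id laurent_one laurent_mul.
Proof.
move=> f; have [n [p fp]] := repP f; apply: laurent_eq; apply: (rep_eq _ fp).
rewrite -[n]add0n -[p]mul1r; apply: rep_conv fp => l /=.
rewrite addr0; case: l => [k|k]; last by [].
by rewrite coef1; case: k.
Qed.

Lemma laurent_mulDl : left_distributive laurent_mul +%R.
Proof.
move=> f g h; have [o [r hr]] := repP h.
have [n fn] := laurent_bound f; have [m gm] := laurent_bound g.
have [p fp] := bound_rep fn (leq_maxl n m).
have [q gq] := bound_rep gm (leq_maxr n m).
apply: laurent_eq.
have fg : rep (laurent_coef (f + g)) (maxn n m) (p + q).
  move=> l /=; rewrite fp gq; case: (l + _%:Z) => k; by rewrite ?coefD ?addr0.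
apply: (rep_eq (rep_conv fg hr)) => l.
transitivity (conv (laurent_coef f) (laurent_coef h) l +
              conv (laurent_coef g) (laurent_coef h) l) => //.
rewrite (rep_conv fp hr) (rep_conv gq hr) mulrDl.
by case: (l + _%:Z) => k; rewrite ?coefD ?addr0.
Qed.

Lemma laurent_one_neq0 : laurent_one != 0.
Proof.
by apply/eqP => /(congr1 (fun f => laurent_coef f 0)) /= /eqP; rewrite oner_eq0.
Qed.

HB.instance Definition _ := GRing.Zmodule_isComNzRing.Build (laurent A)
  laurent_mulA laurent_mulC laurent_mul1 laurent_mulDl laurent_one_neq0.

End LaurentRing.

Section LaurentAlg.
Variables (B : comNzRingType) (A : comAlgType B).
Implicit Types f g : laurent A.

Lemma laurent_scale_bound (c : B) f : exists n : nat, forall l : int,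
  (n < `|l|)%N -> (fun k => c *: laurent_coef f k) l = 0.
Proof. by case: (laurent_bound f) => n fn; exists n => l /fn ->; rewrite scaler0. Qed.
Definition laurent_scale (c : B) f : laurent A :=
  Laurent (laurent_scale_bound c f).

Lemma laurent_scaleA a b f :
  laurent_scale a (laurent_scale b f) = laurent_scale (a * b) f.
Proof. by apply: laurentP => k /=; rewrite scalerA. Qed.
Lemma laurent_scale1 : left_id 1 laurent_scale.
Proof. by move=> f; apply: laurentP => k /=; rewrite scale1r. Qed.
Lemma laurent_scaleDr : right_distributive laurent_scale +%R.
Proof. by move=> a f g; apply: laurentP => k /=; rewrite scalerDr. Qed.
Lemma laurent_scaleDl f : {morph laurent_scale^~ f : a b / a + b}.
Proof. by move=> a b; apply: laurentP => k /=; rewrite scalerDl. Qed.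

HB.instance Definition _ := GRing.Zmodule_isLmodule.Build B (laurent A)
  laurent_scaleA laurent_scale1 laurent_scaleDr laurent_scaleDl.

Lemma laurent_scaleAl (a : B) f g : a *: (f * g) = (a *: f) * g.
Proof.
have aE h : a *: h = laurent_mono 0 a%:A * h.
  apply: laurentP => l /=; rewrite (fsbigE [:: 0])//=.
    by rewrite big_cons big_nil in_setT addr0 eqxx subr0 -scalerAl mul1r.
  by move=> k _; rewrite inE => /negPf ->; rewrite mul0r.
by rewrite !aE mulrA.
Qed.

HB.instance Definition _ :=
  GRing.Lmodule_isLalgebra.Build B (laurent A) laurent_scaleAl.
HB.instance Definition _ := GRing.Lalgebra_isComAlgebra.Build B (laurent A).

End LaurentAlg.

(* The half-integer k + 1/2 is encoded by the integer k.  Thus m + 1/2 is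
   [Posz m], -n - 1/2 is [Negz n], and r < 0 becomes k < 0. *)
Definition negatives : set int := [set k | k < 0].

Definition admissible (A : set int) : bool :=
  `[< finite_set (negatives `\` A) /\ finite_set (A `\` negatives) >].

Notation maya := {A : set int | admissible A}.

Lemma negatives_admissible : admissible negatives.
Proof. by apply/asboolP; rewrite setDv; split; exact: finite_set0. Qed.

Definition vacuum_maya : maya := exist _ negatives negatives_admissible.

(* S : state n labels the basis vector
   S_0 (x) S_1 (x) ... (x) S_(n-1) of F_0 (x) ... (x) F_(n-1). *)
Notation state n := {ffun 'I_n -> maya}.

(* Formal, possibly infinite, combinations of basis vectors. *)
Definition fock (K : Type) (n : nat) : Type := state n -> K.

(* Parity, as a natural number, of a basis vector; the vacuum is even. *)
Definition parity (A : maya) : nat :=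
  (#|` fset_set (sval A `\` negatives)| +
   #|` fset_set (negatives `\` sval A)|)%N.

Definition koszul n (i : 'I_n) (S : state n) : nat :=
  (\sum_(j < n | (j < i)%N) parity (S j))%N.

(* Number of elements of A greater than r. *)
Definition above (A : maya) (r : int) : nat :=
  #|` fset_set [set k | sval A k /\ r < k]|.

Definition same_off n (i : 'I_n) (S T : state n) : Prop :=
  forall j, j != i -> T j = S j.

Section Operators.
Variables (K : comAlgType rat) (n : nat).

(* Coefficient of T in psi^i_r S. *)
Definition psi_coef (i : 'I_n) (r : int) (S T : state n) : K :=
  if `[< [/\ ~ sval (S i) r, sval (T i) = r |` sval (S i) & same_off i S T] >]
  then (-1) ^+ (koszul i S + above (S i) r)
  else 0.

(* Coefficient of T in psi^{i*}_r S; the position of r in S_i is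
   (above (S i) r).+1. *)
Definition psis_coef (i : 'I_n) (r : int) (S T : state n) : K :=
  if `[< [/\ sval (S i) r, sval (T i) = sval (S i) `\ r & same_off i S T] >]
  then (-1) ^+ (koszul i S + (above (S i) r).+2)
  else 0.

Definition psi (i : 'I_n) (r : int) (v : fock K n) : fock K n :=
  fun T => \sum_(S \in [set: state n]) v S * psi_coef i r S T.

Definition psis (i : 'I_n) (r : int) (v : fock K n) : fock K n :=
  fun T => \sum_(S \in [set: state n]) v S * psis_coef i r S T.

Definition vacuum : fock K n := fun S => (S == [ffun=> vacuum_maya])%:R.

End Operators.

(* [A i j m n] is the coefficient of psi^i_(m+1/2) psi^{j*}_(-n-1/2). *)
Definition coefs (K : Type) (n : nat) : Type := 'I_n -> 'I_n -> nat -> nat -> K.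

Section Bogoliubov.
Variables (K : comAlgType rat) (N : nat).

Definition bilinear_op (A : coefs K N) (v : fock K N) : fock K N :=
  fun T => \sum_(x \in [set: 'I_N * 'I_N * nat * nat])
    let: (i, j, m, n) := x in A i j m n * psi i (Posz m) (psis j (Negz n) v) T.

(* exp (sum A psi psi^* ) |0> ; at a fixed T only the power k equal to the
   number of nonnegative elements of T contributes. *)
Definition bogoliubov (A : coefs K N) : fock K N :=
  fun T => \sum_(k \in [set: nat])
    (k`!%:R^-1 : rat) *: iter k (bilinear_op A) (@vacuum K N) T.

End Bogoliubov.

(* R[Theta, Theta^-1][[Q]] *)
Notation series R := (fps (laurent R)).

Section Gluing.
Variable R : comAlgType rat.

(* c Q^d Theta^e *)
Definition monomial (d : nat) (e : int) (c : R) : series R :=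
  Fps (fun k => if k == d then laurent_mono e c else 0).

Definition embed n (A : coefs R n) : coefs (series R) n :=
  fun i j k l => monomial 0 0 (A i j k l).

(* Inner product on F_a (x) F_b; for the vectors below the sum converges
   Q-adically, that is, each coefficient is a finite sum. *)
Definition inner (v w : fock (series R) 2) : series R :=
  Fps (fun k => \sum_(T \in [set: state 2]) fps_coef (v T * w T) k).

Definition join_state n (S : state n) (T : state 2) : state (n + 2) :=
  [ffun i => match fintype.split i with inl i' => S i' | inr i' => T i' end].

(* Inner product over the last two factors. *)
Definition partial_inner n (v : fock (series R) (n + 2)) (w : fock (series R) 2) :
    fock (series R) n :=
  fun S => inner (fun T => v (join_state S T)) w.

(* The indices a, b of F_a (x) F_b are 0, 1 : 'I_2; this is epsilon_ij. *)
Definition theta_exp (i j : 'I_2) : int := j%:Z - i%:Z.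

Definition gluing_vector (E : coefs R 2) : fock (series R) 2 :=
  bogoliubov (fun i j m n => monomial (m + n + 1) (theta_exp i j) (E i j m n)).

Section TwoTransforms.
Variables (M N : nat).

(* V_1 = bogoliubov A1 in F_1 (x) ... (x) F_M (x) F_a and
   V_2 = bogoliubov A2 in F_(M+1) (x) ... (x) F_(M+N) (x) F_b, where a and b are
   the last indices, [rshift M 0] and [rshift N 0].  The factors of the tensor
   product are ordered 1, ..., M+N, a, b; [component i] tells whether the i-th
   one comes from V_1 or from V_2. *)
Definition component (i : 'I_(M + N + 2)) : 'I_(M + 1) + 'I_(N + 1) :=
  match fintype.split i with
  | inl i' => match fintype.split i' with
              | inl i1 => inl (lshift 1 i1)
              | inr i2 => inr (lshift 1 i2)
              end
  | inr c => if c == 0 then inl (rshift M 0) else inr (rshift N 0)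
  end.

Definition tensor_coefs (A1 : coefs R (M + 1)) (A2 : coefs R (N + 1)) :
    coefs R (M + N + 2) :=
  fun i j => match component i, component j with
             | inl i1, inl j1 => A1 i1 j1
             | inr i2, inr j2 => A2 i2 j2
             | _, _ => fun _ _ => 0
             end.

Variables (E : coefs R 2) (A1 : coefs R (M + 1)) (A2 : coefs R (N + 1)).

Definition gluing : fock (series R) (M + N) :=
  partial_inner (bogoliubov (embed (tensor_coefs A1 A2))) (gluing_vector E).

Definition closed_coefs : coefs R 2 :=
  fun i j => tensor_coefs A1 A2 (rshift (M + N) i) (rshift (M + N) j).

Definition gluing_closed : series R :=
  inner (bogoliubov (embed closed_coefs)) (gluing_vector E).

Definition normalized_gluing : fock (series R) (M + N) :=
  fun S => gluing S / gluing_closed.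

End TwoTransforms.
End Gluing.

(* Main.v *)
(* A vector exp(sum A psi psi^* )|0> is characterised, among charge 0 vectors
   with vacuum coefficient 1, by the linear relations
     psi^{i*}_(m+1/2) V = sum_(j,n) A^{ij}_mn psi^{j*}_(-n-1/2) V,
   and it also satisfies psi^j_(-n-1/2) V = - sum_(i,m) A^{ij}_mn psi^i_(m+1/2) V.
   Pair the relations of V with the gluing vector P: moving the operators of the
   factors a, b to P by adjunction and applying the relations of P, the vectors
   X = (psi^{c*}_(-n-1/2) V, P), c = a, b, satisfy a linear system
   X = - B (A_ext Y + A_int X), Y = (psi^{j*}_(-n-1/2) V, P) with j external.
   Since B is divisible by Q this system is contracting, so X, and with it
   psi^{i*}_(m+1/2) (V, P), is a linear combination of the Y. *)

Require Import Defs.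
From HB Require Import structures.
From mathcomp Require Import all_boot all_order all_algebra.
From mathcomp Require Import finmap boolp classical_sets functions cardinality.
From mathcomp Require Import fsbigop zify ring.

Set Implicit Arguments.
Unset Strict Implicit.
Unset Printing Implicit Defensive.

Import Order.TTheory GRing.Theory Num.Theory.

(** * Maya diagrams and basis states *)

Section Toggle.
Local Open Scope classical_set_scope.
Local Open Scope ring_scope.
Implicit Types (A B : set int) (r s k : int) (a : maya).

(** Symmetric difference with the one-point set of r: a single involution covers both insertion and
    removal, so [psi] and [psi^*] can be treated alike. *)
Definition toggle r A : set int := [set k | (k \in A) (+) (k == r)].

Lemma in_toggle r A k : (k \in toggle r A) = (k \in A) (+) (k == r).
Proof. by apply/idP/idP; rewrite inE. Qed.

Lemma eq_set_in A B : (forall k, (k \in A) = (k \in B)) -> A = B.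
Proof.
by move=> AB; apply/seteqP; split=> k /mem_set kA; apply: set_mem;
  rewrite ?AB// -AB.
Qed.

Lemma toggleK r : involutive (toggle r).
Proof. by move=> A; apply: eq_set_in => k; rewrite !in_toggle addbK. Qed.

Lemma finite_absz_lt K : finite_set [set k : int | (`|k| < K)%N].
Proof.
apply: (sub_finite_set _ (finite_image (fun n : nat => n%:Z - K%:Z)
  (finite_II (K + K)%N))) => k /= kK.
by exists (absz (k + K%:Z)); rewrite /=; lia.
Qed.

(** Both differences are finite sets of integers, hence bounded. The explicit bound K later provides
    the finite boxes of modes. *)
Lemma admissibleP A :
  admissible A <-> exists K : nat, forall k, k \in A != (k < 0) -> (`|k| < K)%N.
Proof.
split=> [/asboolP[fA fB]|[K AK]].
  pose X := fset_set ((negatives `\` A) `|` (A `\` negatives)).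
  exists (\max_(k <- X) `|k|).+1%N => k kA; rewrite ltnS.
  apply: (@leq_bigmax_seq _ _ _ (fun k : int => `|k|%N) k) => //.
  rewrite in_fset_set ?finite_setU// in_setU !in_setD.
  have -> : (k \in negatives) = (k < 0) by apply/idP/idP; rewrite inE.
  by move: kA; case: (k \in A); case: (k < 0).
apply/asboolP; split; apply: sub_finite_set (finite_absz_lt K) => k [] /=.
  move=> k0 kA; apply: AK; rewrite /negatives /= in k0.
  by rewrite k0 (memNset kA).
by move=> kA /negP k0; apply: AK; rewrite (mem_set kA) (negPf k0).
Qed.

Lemma toggle_admissible r a : admissible (toggle r (sval a)).
Proof.
have [K aK] := (admissibleP (sval a)).1 (svalP a).
apply/admissibleP; exists (maxn K `|r|.+1) => k.
rewrite in_toggle leq_max ltnS.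
have [->|_] := eqVneq k r; first by rewrite leqnn orbT.
by rewrite addbF => /aK ->.
Qed.

Definition maya_toggle r a : maya := 
  exist (fun A => admissible A) _ (toggle_admissible r a).

(* Filled for r >= 0, or empty for r < 0. *)
Definition excited r a : bool := (r \in sval a) (+) (r < 0).

Definition nparticles a : nat := #|` fset_set (sval a `\` negatives)|.
Definition nholes a : nat := #|` fset_set (negatives `\` sval a)|.

Lemma maya_eq a b : (forall k, excited k a = excited k b) -> a = b.
Proof.
move=> ab; apply: val_inj; apply: eq_set_in => k.
by apply: (@addIb (k < 0)); exact: ab.
Qed.

Lemma maya_toggleK r : involutive (maya_toggle r).
Proof. by move=> a; apply: val_inj; rewrite /= toggleK. Qed.

Lemma in_negatives r : (r \in negatives) = (r < 0).
Proof. by apply/idP/idP; rewrite inE. Qed.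

Lemma excited_toggle r s a :
  excited r (maya_toggle s a) = excited r a (+) (r == s).
Proof. by rewrite /excited in_toggle addbAC. Qed.

Lemma card_add1 A B r : finite_set A -> r \notin A ->
  (forall k, (k \in B) = (k \in A) || (k == r)) ->
  #|` fset_set B| = (#|` fset_set A|).+1.
Proof.
move=> fA rA BA; have -> : B = r |` A.
  by apply: eq_set_in => k; rewrite BA in_setU in_set1 orbC.
by rewrite fset_setU1// cardfsU1 in_fset_set// rA.
Qed.

Lemma finite_particles a : finite_set (sval a `\` negatives).
Proof. by have /asboolP[] := svalP a. Qed.

Lemma finite_holes a : finite_set (negatives `\` sval a).
Proof. by have /asboolP[] := svalP a. Qed.

Lemma nparticles_toggle r a : ~~ excited r a ->
  nparticles (maya_toggle r a) = (nparticles a + (0 <= r)%R)%N.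
Proof.
rewrite /excited /nparticles leNgt => ra.
case: ltP ra => r0 ra; last first.
  rewrite addn1; apply: (@card_add1 _ _ r); first exact: finite_particles.
    by rewrite in_setD in_negatives; move: ra; rewrite addbF => /negPf ->.
  move=> k; rewrite !in_setD in_toggle in_negatives.
  case: (eqVneq k r) => [->|_]; last by rewrite addbF orbF.
  by rewrite orbT ltNge r0 andbT; case: (_ \in _) ra.
rewrite addn0; congr #|` fset_set _|; apply: eq_set_in => k.
rewrite !in_setD in_toggle in_negatives.
by case: (eqVneq k r) => [->|_]; rewrite ?addbF// r0 !andbF.
Qed.

Lemma nholes_toggle r a : ~~ excited r a ->
  nholes (maya_toggle r a) = (nholes a + (r < 0)%R)%N.
Proof.
rewrite /excited /nholes => ra.
case: ltP ra => r0 ra.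
  rewrite addn1; apply: (@card_add1 _ _ r); first exact: finite_holes.
    by rewrite in_setD in_negatives r0; move: ra; rewrite addbT negbK => ->.
  move=> k; rewrite !in_setD in_toggle in_negatives.
  case: (eqVneq k r) => [->|_]; last by rewrite addbF orbF.
  by rewrite orbT r0; case: (_ \in _) ra.
rewrite addn0; congr #|` fset_set _|; apply: eq_set_in => k.
rewrite !in_setD in_toggle in_negatives.
by case: (eqVneq k r) => [->|_]; rewrite ?addbF// ltNge r0.
Qed.

Lemma parityE a : parity a = (nparticles a + nholes a)%N.
Proof. by []. Qed.

Lemma odd_parity_toggle r a : odd (parity (maya_toggle r a)) = ~~ odd (parity a).
Proof.
(* Toggling is an involution, so the excited case follows from the unexcited one applied to the
   toggled diagram. *)
wlog ra : a / ~~ excited r a => [H|].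
  case: (boolP (excited r a)) => [ra|/H //].
  have := H (maya_toggle r a); rewrite excited_toggle eqxx ra maya_toggleK.
  by move=> /(_ isT) ->; rewrite negbK.
rewrite !parityE nparticles_toggle// nholes_toggle// leNgt.
by case: (r < 0); rewrite ?addn0 ?addn1 ?addnS.
Qed.

Lemma in_above a r k :
  (k \in [set k | sval a k /\ r < k]) = (k \in sval a) && (r < k).
Proof.
apply/idP/andP => [/set_mem[ak rk]|[ak rk]]; first by rewrite mem_set.
by apply: mem_set; split => //; apply: set_mem.
Qed.

Lemma finite_above a r : finite_set [set k | sval a k /\ r < k].
Proof.
have [K aK] := (admissibleP (sval a)).1 (svalP a).
apply: (sub_finite_set _
  (finite_absz_lt (maxn K `|r|.+1))) => k [/mem_set ak rk] /=.
rewrite leq_max; have := aK k; rewrite ak; case: (ltP k 0) => [k0 _|_ -> //].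
by apply/orP; right; lia.
Qed.

Lemma odd_above_toggle r s a :
  odd (above (maya_toggle s a) r) = odd (above a r) (+) (r < s).
Proof.
wlog sa : a / s \notin sval a => [H|].
  case: (boolP (s \in sval a)) => [sa|/H //].
  have := H (maya_toggle s a); rewrite in_toggle eqxx sa maya_toggleK.
  by move=> /(_ isT) ->; rewrite addbK.
case: (ltP r s) => rs.
  rewrite /above (@card_add1 [set k | sval a k /\ r < k] _ s) ?addbT//.
  - exact: finite_above.
  - by rewrite in_above (negPf sa).
  - move=> k; rewrite !in_above in_toggle; case: (eqVneq k s) => [->|_].
      by rewrite (negPf sa) rs.
    by rewrite addbF orbF.
rewrite addbF; congr (odd #|` fset_set _|); apply: eq_set_in => k.
rewrite !in_above in_toggle; case: (eqVneq k s) => [->|_]; last by rewrite addbF.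
by rewrite ltNge rs !andbF.
Qed.

End Toggle.

(** * Basis states of a tensor product: signs, gradings and finite boxes *)

Section States.
Local Open Scope ring_scope.
Variable n : nat.
Notation site := ('I_n * int)%type.
Implicit Types (x y : site) (S T : state n).

Definition exc x T : bool := excited x.2 (T x.1).

Definition flip x T : state n :=
  [ffun i => if i == x.1 then maya_toggle x.2 (T i) else T i].

(* Position in the wedge: earlier tensor factor, then larger half-integer. *)
Definition before x y : bool :=
  (x.1 < y.1)%N || (x.1 == y.1) && (y.2 < x.2).

(** The sign exponent of [psi_coef] and [psis_coef] modulo 2: the Koszul sign of the earlier factors
    together with the position in the wedge. *)
Definition sgn x T : bool := odd (koszul x.1 T + above (T x.1) x.2).

Lemma state_eq S T : (forall x, exc x S = exc x T) -> S = T.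
Proof.
by move=> ST; apply/ffunP => i; apply: maya_eq => k; exact: (ST (i, k)).
Qed.

Lemma exc_flip x y T : exc x (flip y T) = exc x T (+) (x == y).
Proof.
rewrite /exc ffunE -pair_eqE /=; case: eqP => _; last by rewrite addbF.
exact: excited_toggle.
Qed.

Lemma flipK x : involutive (flip x).
Proof. by move=> T; apply: state_eq => y; rewrite !exc_flip addbK. Qed.

Lemma flipC x y T : flip x (flip y T) = flip y (flip x T).
Proof. by apply: state_eq => z; rewrite !exc_flip addbAC. Qed.

Lemma flip_eq x S T : (flip x S == T) = (S == flip x T).
Proof. by apply/eqP/eqP => [<-|->]; rewrite flipK. Qed.

Definition vac : state n := [ffun=> vacuum_maya].

Lemma exc_vac x : exc x vac = false.
Proof. by rewrite /exc ffunE /excited /= in_negatives addbb. Qed.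

Lemma vacP T : T = vac \/ exists x, exc x T.
Proof.
case: (pselect (exists x, exc x T)); first by right.
move=> H; left; apply: state_eq => x; rewrite exc_vac.
by apply/negbTE/negP => xT; apply: H; exists x.
Qed.

Lemma before_irr x : before x x = false.
Proof. by rewrite /before ltnn ltxx andbF. Qed.

Lemma before_neg x y : x != y -> before x y = ~~ before y x.
Proof.
case: x y => [i r] [j s]; rewrite -pair_eqE /before /= (eq_sym j).
case: (eqVneq i j) => [->|ij] /=.
  by rewrite ltnn /= -leNgt le_eqVlt eq_sym orbC => /negPf ->; rewrite orbF.
by move=> _; rewrite !orbF -leqNgt ltn_neqAle val_eqE ij.
Qed.

(** Only the factor [x.1] changes. The additive form avoids subtraction in nat and serves parities,
    particles and holes at once. *)
Lemma big_flip (f : maya -> nat) (P : pred 'I_n) x T :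
  (\sum_(j | P j) f (flip x T j) + P x.1 * f (T x.1) =
   \sum_(j | P j) f (T j) + P x.1 * f (maya_toggle x.2 (T x.1)))%N.
Proof.
case: (boolP (P x.1)) => Px.
  rewrite (bigD1 x.1)//= [in RHS](bigD1 x.1)//= ffunE eqxx !mul1n.
  rewrite addnAC (addnC (f _) (f (T x.1))) addnAC.
  congr (_ + _ + _)%N; apply: eq_bigr => j /andP[_ /negPf jx].
  by rewrite ffunE jx.
rewrite !mul0n !addn0; apply: eq_bigr => j Pj; rewrite ffunE.
by case: eqP Px => // <-; rewrite Pj.
Qed.

(** The sign at x counts only what precedes x: earlier factors through [koszul], larger
    half-integers of the same factor through [above]. All anticommutation relations come from
    this. *)
Lemma sgn_flip x y T : sgn x (flip y T) = sgn x T (+) before y x.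
Proof.
rewrite /sgn !oddD /koszul.
have := congr1 odd (big_flip parity (fun j => (j < x.1)%N) y T).
rewrite !oddD !oddM odd_parity_toggle oddb /before ffunE.
set p := odd (\sum_(j < n | _) parity (flip _ _ _)).
set q := odd (\sum_(j < n | _) _).
case: (eqVneq y.1 x.1) => [yx|yx] /=.
  by rewrite -yx ltnn /= !addbF => ->; rewrite odd_above_toggle addbA.
rewrite orbF; case: (_ < _)%N; last by rewrite !addbF => ->.
move=> pq; have -> : p = ~~ q by move: pq; case: p q (odd (parity _)) => [] [] [].
by rewrite addbT addNb.
Qed.

Lemma sgn_flip_id x T : sgn x (flip x T) = sgn x T.
Proof. by rewrite sgn_flip before_irr addbF. Qed.

Definition npart T : nat := (\sum_i nparticles (T i))%N.
Definition nhole T : nat := (\sum_i nholes (T i))%N.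

Lemma npart_flip x T : ~~ exc x T ->
  npart (flip x T) = (npart T + (0 <= x.2)%R)%N.
Proof.
move=> xT; have := big_flip nparticles predT x T.
by rewrite /npart /= nparticles_toggle// !mul1n => H; lia.
Qed.

Lemma nhole_flip x T : ~~ exc x T ->
  nhole (flip x T) = (nhole T + (x.2 < 0)%R)%N.
Proof.
move=> xT; have := big_flip nholes predT x T.
by rewrite /nhole /= nholes_toggle// !mul1n => H; lia.
Qed.

Lemma flip_unexc x T : exc x T -> ~~ exc x (flip x T).
Proof. by rewrite exc_flip eqxx => ->. Qed.

Lemma npart_unflip x T : exc x T -> npart T = (npart (flip x T) + (0 <= x.2)%R)%N.
Proof. by move=> xT; rewrite -npart_flip ?flip_unexc// flipK. Qed.

Lemma nhole_unflip x T : exc x T -> nhole T = (nhole (flip x T) + (x.2 < 0)%R)%N.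
Proof. by move=> xT; rewrite -nhole_flip ?flip_unexc// flipK. Qed.

Lemma npart_vac : npart vac = 0%N.
Proof.
rewrite /npart big1 // => i _; rewrite ffunE /nparticles /= setDv.
by rewrite fset_set0.
Qed.

Lemma nhole_vac : nhole vac = 0%N.
Proof.
rewrite /nhole big1 // => i _; rewrite ffunE /nholes /= setDv.
by rewrite fset_set0.
Qed.

(** The mode number: m + 1/2 and -m - 1/2 both get m, in agreement with the indices of the
    coefficient arrays. *)
Definition idx (r : int) : nat := match r with Posz m | Negz m => m end.

(** Truncation to the N lowest modes of each factor; on such states the infinite sums over modes
    become sums over ['I_N]. *)
Definition boxed N T : Prop := forall x, exc x T -> (idx x.2 < N)%N.

Lemma boxed_leq N N' T : (N <= N')%N -> boxed N T -> boxed N' T.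
Proof. by move=> NN' NT x /NT /leq_trans; apply. Qed.

Lemma boxed_flip N x T : (idx x.2 < N)%N -> boxed N T -> boxed N (flip x T).
Proof.
move=> xN NT y; rewrite exc_flip; have [-> //|_] := eqVneq y x.
by rewrite addbF => /NT.
Qed.

Lemma boxed_vac N : boxed N vac.
Proof. by move=> x; rewrite exc_vac. Qed.

Lemma boxed_exists T : exists N, boxed N T.
Proof.
pose N i := proj1_sig (cid ((admissibleP (sval (T i))).1 (svalP (T i)))).
exists (\max_i N i).+1 => -[i r] xT; rewrite ltnS /=.
apply: leq_trans (leq_bigmax i).
have := proj2_sig (cid ((admissibleP (sval (T i))).1 (svalP (T i)))) r.
rewrite -/(N i); have -> : (r \in sval (T i)) != (r < 0) 
  by move: xT; rewrite /exc /excited /=; case: (_ \in _); case: (_ < _).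
by move=> /(_ isT); case: r {xT} => m; rewrite /idx; lia.
Qed.

(** A boxed state is determined by a boolean pattern on the finitely many sites of the box. *)
Lemma finite_boxed N : finite_set [set T | boxed N T]%classic.
Proof.
pose site_of (k : 'I_n * 'I_N * bool) : site :=
  (k.1.1, if k.2 then Posz k.1.2 else Negz k.1.2).
pose code T := [ffun k => exc (site_of k) T].
have inj : {in [set T | boxed N T]%classic &, injective code}.
  move=> S T /set_mem /= NS /set_mem /= NT /ffunP ST; apply: state_eq => -[i r].
  case: (ltnP (idx r) N) => rN; last first.
    have F U : boxed N U -> exc (i, r) U = false.
      by move=> NU; apply/negbTE/negP => /NU; rewrite ltnNge rN.
    by rewrite !F.
  case: r rN => m mN.
    by have := ST (i, Ordinal mN, true); rewrite !ffunE.
  by have := ST (i, Ordinal mN, false); rewrite !ffunE.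
(* Patterns are decoded by choice, with [vac] as default for a pattern that no boxed state
   realises. *)
apply: sub_finite_set (finite_image
  (fun f => xget vac [set T | boxed N T /\ code T = f]%classic)
  (@finite_finset _ setT)) => T NT; exists (code T) => //.
by case: xgetP => [U -> [NU /inj]|/(_ T)[]//]; apply; apply: mem_set.
Qed.

Definition box N : seq (state n) := fset_set [set T | boxed N T]%classic.

Lemma box_uniq N : uniq (box N).
Proof. exact: fset_uniq. Qed.

Lemma boxP N T : reflect (boxed N T) (T \in box N).
Proof.
rewrite in_fset_set; last exact: finite_boxed.
by apply: (iffP idP) => [/set_mem|/mem_set].
Qed.

Lemma box_flip N x : (idx x.2 < N)%N -> perm_eq (map (flip x) (box N)) (box N).
Proof.
move=> xN; apply: uniq_perm; rewrite ?map_inj_uniq ?box_uniq//.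
  exact: inv_inj (flipK x).
move=> T; apply/mapP/idP => [[S /boxP NS ->]|/boxP NT].
  exact/boxP/boxed_flip.
by exists (flip x T); [exact/boxP/boxed_flip|rewrite flipK].
Qed.

End States.

(** * Creation and annihilation of excitations *)

Section Clifford.
Local Open Scope ring_scope.
Variables (K : comNzRingType) (n : nat).
Notation site := ('I_n * int)%type.
Implicit Types (x y : site) (S T : state n) (v w : fock K n).

Definition sg x T : K := (-1) ^+ sgn x T.

(* Creation and annihilation of the excitation at x: [cr] is psi if x is
   nonnegative and psi^* if x is negative; [an] is the other one. *)
Definition cr x v : fock K n :=
  fun T => if exc x T then sg x T * v (flip x T) else 0.
Definition an x v : fock K n :=
  fun T => if exc x T then 0 else sg x T * v (flip x T).

Lemma sg_sqr x T : sg x T * sg x T = 1.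
Proof. by rewrite -expr2 sqrr_sign. Qed.

Lemma sg_flip_id x T : sg x (flip x T) = sg x T.
Proof. by rewrite /sg sgn_flip_id. Qed.

Lemma sg_flip x y T : sg x (flip y T) = sg x T * (-1) ^+ before y x.
Proof. by rewrite /sg sgn_flip signr_addb. Qed.

(** Of two distinct sites exactly one precedes the other, so exactly one of the two signs is changed
    by the other flip. *)
Lemma sg_anti x y T : x != y ->
  sg x T * sg y (flip x T) = - (sg y T * sg x (flip y T)).
Proof.
move=> xy; rewrite !sg_flip (before_neg xy).
by case: before; rewrite /= ?expr0 ?expr1; ring.
Qed.

Lemma crC x y v T : cr x (cr y v) T = - cr y (cr x v) T.
Proof.
rewrite /cr !exc_flip (eq_sym y x); have [->|xy] := eqVneq x y.
  by case: (exc y T); rewrite /= ?mulr0 oppr0.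
rewrite !addbF; case: (exc x T); case: (exc y T); rewrite ?mulr0 ?oppr0//.
by rewrite !mulrA sg_anti// flipC mulNr.
Qed.

Lemma an_cr x y v T : x != y -> an x (cr y v) T = - cr y (an x v) T.
Proof.
move=> xy; rewrite /cr /an !exc_flip (eq_sym y x) (negPf xy) !addbF.
case: (exc x T); case: (exc y T); rewrite ?mulr0 ?oppr0//.
by rewrite !mulrA sg_anti// flipC mulNr.
Qed.

Lemma an_cr_id x v T : an x (cr x v) T = v T - cr x (an x v) T.
Proof.
rewrite /cr /an !exc_flip eqxx addbT; case: (exc x T) => /=.
  by rewrite mulrA sg_flip_id sg_sqr mul1r flipK subrr.
by rewrite mulrA sg_flip_id sg_sqr mul1r flipK subr0.
Qed.

Lemma cr_sum x (I : Type) (r : seq I) (P : pred I) (a : I -> K)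
    (F : I -> fock K n) T :
  cr x (fun S => \sum_(i <- r | P i) a i * F i S) T =
  \sum_(i <- r | P i) a i * cr x (F i) T.
Proof.
rewrite /cr; case: ifP => _; last by rewrite big1 // => i _; rewrite mulr0.
by rewrite big_distrr /=; apply: eq_bigr => i _; rewrite mulrCA.
Qed.

Lemma an_sum x (I : Type) (r : seq I) (P : pred I) (a : I -> K)
    (F : I -> fock K n) T :
  an x (fun S => \sum_(i <- r | P i) a i * F i S) T =
  \sum_(i <- r | P i) a i * an x (F i) T.
Proof.
rewrite /an; case: ifP => _; first by rewrite big1 // => i _; rewrite mulr0.
by rewrite big_distrr /=; apply: eq_bigr => i _; rewrite mulrCA.
Qed.

Lemma an_vac x T : an x (fun S => (S == vac n)%:R) T = 0.
Proof.
rewrite /an flip_eq; case: (boolP (exc x T)) => // xT.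
case: eqP => [TE|]; last by rewrite mulr0.
by move: xT; rewrite TE exc_flip exc_vac eqxx.
Qed.

End Clifford.

(** * Bogoliubov transforms *)

Section Exponential.
Local Open Scope ring_scope.
Variables (K : comAlgType rat) (n : nat).
Notation site := ('I_n * int)%type.
Implicit Types (x y : site) (S T : state n) (v w : fock K n) (A : coefs K n).

Lemma flip_insertP i r S T :
  [/\ ~ sval (S i) r, sval (T i) = r |` sval (S i) & same_off i S T]%classic <->
  r \notin sval (S i) /\ T = flip (i, r) S.
Proof.
split=> [[rS TS off]|[rS ->]].
  have rS' : r \notin sval (S i) by apply/negP => /set_mem.
  split=> //; apply/ffunP => j; rewrite ffunE /=; case: eqVneq => [->|/off//].
  apply: val_inj => /=; rewrite TS; apply: eq_set_in => k.
  rewrite in_toggle in_setU in_set1 orbC.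
  by case: (eqVneq k r) => [->|]; rewrite ?(negPf rS') ?orbF ?addbF.
split; first by move=> /mem_set; apply/negP.
  rewrite ffunE eqxx /=; apply: eq_set_in => k.
  rewrite in_toggle in_setU in_set1 orbC.
  by case: (eqVneq k r) => [->|]; rewrite ?(negPf rS) ?orbF ?addbF.
by move=> j ji; rewrite ffunE (negPf ji).
Qed.

(** The only basis vector that [psi] can send to a multiple of T is [flip (i, r) T], so the sum has
    at most one term. *)
Lemma psiE i r v T : psi i r v T =
  if r \in sval (T i) then sg K (i, r) T * v (flip (i, r) T) else 0.
Proof.
rewrite /psi (fsbigE [:: flip (i, r) T])//=; last first.
  move=> S _; rewrite inE => ST; rewrite /psi_coef.
  case: asboolP; last by rewrite mulr0.
  by move=> /flip_insertP[_ TS]; move: ST; rewrite TS flipK eqxx.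
rewrite big_cons big_nil in_setT addr0 /psi_coef.
case: asboolP => [/flip_insertP[rT _]|rT].
  have -> : r \in sval (T i).
    by move: rT; rewrite ffunE eqxx in_toggle eqxx addbT negbK.
  by rewrite mulrC -signr_odd -/(sgn (i, r) _) -/(sg K (i, r) _) sg_flip_id.
case: (boolP (r \in _)) => rTi; last by rewrite mulr0.
by case: rT; apply/flip_insertP; rewrite flipK ffunE eqxx in_toggle rTi eqxx.
Qed.

Lemma psisE i r v T : psis i r v T =
  if r \in sval (T i) then 0 else sg K (i, r) T * v (flip (i, r) T).
Proof.
have removeP S :
    [/\ sval (S i) r, sval (T i) = sval (S i) `\ r
      & same_off i S T]%classic <->
    r \in sval (S i) /\ T = flip (i, r) S.
  split=> [[rS TS off]|[rS ->]].
    have rS' := mem_set rS.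
    split=> //; apply/ffunP => j; rewrite ffunE /=; case: eqVneq => [->|/off//].
    apply: val_inj => /=; rewrite TS; apply: eq_set_in => k.
    rewrite in_toggle in_setD in_set1.
    by case: (eqVneq k r) => [->|]; rewrite ?rS' ?andbT ?addbF.
  split; first exact: set_mem.
    rewrite ffunE eqxx /=; apply: eq_set_in => k.
    rewrite in_toggle in_setD in_set1.
    by case: (eqVneq k r) => [->|]; rewrite ?rS ?andbT ?addbF.
  by move=> j ji; rewrite ffunE (negPf ji).
rewrite /psis (fsbigE [:: flip (i, r) T])//=; last first.
  move=> S _; rewrite inE => ST; rewrite /psis_coef.
  case: asboolP; last by rewrite mulr0.
  by move=> /removeP[_ TS]; move: ST; rewrite TS flipK eqxx.
rewrite big_cons big_nil in_setT addr0 /psis_coef.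
case: asboolP => [/removeP[rT _]|rT].
  have /negPf -> : r \notin sval (T i).
    by move: rT; rewrite ffunE eqxx in_toggle eqxx addbT.
  (* The exponent of [psis_coef] exceeds that of [sgn] by 2, so the signs agree. *)
  rewrite mulrC -signr_odd !addnS /= negbK -/(sgn (i, r) _) -/(sg K (i, r) _).
  by rewrite sg_flip_id.
case: (boolP (r \in _)) => rTi; first by rewrite mulr0.
by case: rT; apply/removeP; rewrite flipK ffunE eqxx in_toggle (negPf rTi) eqxx.
Qed.

Lemma psi_cr i m v : psi i (Posz m) v = cr (i, Posz m) v.
Proof. by apply/funext => T; rewrite psiE /cr /exc /excited /= addbF. Qed.

Lemma psis_cr i m v : psis i (Negz m) v = cr (i, Negz m) v.
Proof. by apply/funext => T; rewrite psisE /cr /exc /excited /= addbT if_neg. Qed.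

Definition part N (k : 'I_n * 'I_N) : site := (k.1, Posz k.2).
Definition hole N (k : 'I_n * 'I_N) : site := (k.1, Negz k.2).

Lemma part_hole N (k l : 'I_n * 'I_N) : part k != hole l.
Proof. by rewrite -pair_eqE /= andbF. Qed.

Lemma part_eq N (k l : 'I_n * 'I_N) : (part k == part l) = (k == l).
Proof. by rewrite -!pair_eqE. Qed.

Lemma hole_eq N (k l : 'I_n * 'I_N) : (hole k == hole l) = (k == l).
Proof. by rewrite -!pair_eqE. Qed.

Lemma boxed_part N (k : 'I_n * 'I_N) T : boxed N T -> boxed N (flip (part k) T).
Proof. exact/boxed_flip/ltn_ord. Qed.

Lemma boxed_hole N (l : 'I_n * 'I_N) T : boxed N T -> boxed N (flip (hole l) T).
Proof. exact/boxed_flip/ltn_ord. Qed.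

(** The truncation of [bilinear_op] to modes below N. *)
Definition bop N A v : fock K n := fun T =>
  \sum_(k : 'I_n * 'I_N) \sum_(l : 'I_n * 'I_N)
    A k.1 l.1 k.2 l.2 * cr (part k) (cr (hole l) v) T.

Lemma bilinear_opE N A v T : boxed N T -> bilinear_op A v T = bop N A v T.
Proof.
move=> NT; rewrite /bilinear_op.
pose f (x : ('I_n * 'I_N) * ('I_n * 'I_N)) : 'I_n * 'I_n * nat * nat :=
  (x.1.1, x.2.1, x.1.2 : nat, x.2.2 : nat).
have f_inj : injective f.
  by move=> [[i m] [j b]] [[i' m'] [j' b']] [-> -> /val_inj -> /val_inj ->].
rewrite (fsbigE [seq f z | z <- enum {: ('I_n * 'I_N) * ('I_n * 'I_N)}])//;
  last first.
(* A nonzero term requires T to contain both the particle m and the hole b, so both modes are below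
   N. *)
- move=> [[[i j] m] b] _ /mapP Hf; rewrite psi_cr psis_cr.
  rewrite /cr; case: ifP => [mT|]; last by rewrite mulr0.
  case: ifP => [bT|]; last by rewrite !mulr0.
  have mN : (m < N)%N := NT _ mT.
  have bN : (b < N)%N.
    by move: bT; rewrite exc_flip -pair_eqE /= andbF addbF => /NT.
  by case: Hf; exists ((i, Ordinal mN), (j, Ordinal bN)); rewrite ?mem_enum.
- by rewrite map_inj_uniq ?enum_uniq.
rewrite big_map big_enum_cond /= /bop pair_big /=.
by apply: eq_big => [z|z _]; rewrite ?in_setT ?psi_cr ?psis_cr.
Qed.

Lemma sum_delta (I : finType) (i0 : I) (F : I -> K) :
  \sum_i (if i0 == i then F i else 0) = F i0.
Proof.
by rewrite -big_mkcond (eq_bigl (pred1 i0)) ?big_pred1_eq // => i; rewrite eq_sym.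
Qed.

Section Bop.
Variables (N : nat) (A : coefs K n).
Implicit Types (k l : 'I_n * 'I_N).

(** The operator paired with [cr (part k)] in [bop]. Its counterpart [crp], paired with
    [cr (hole l)], has a minus sign because the two creators are exchanged. *)
Definition crh k v : fock K n := fun T =>
  \sum_(l : 'I_n * 'I_N) A k.1 l.1 k.2 l.2 * cr (hole l) v T.
Definition crp l v : fock K n := fun T =>
  \sum_(k : 'I_n * 'I_N) - A k.1 l.1 k.2 l.2 * cr (part k) v T.

Lemma bop_crh v T : bop N A v T = \sum_k cr (part k) (crh k v) T.
Proof. by apply: eq_bigr => k _; rewrite cr_sum. Qed.

(** The operator [an (part k)] anticommutes with every creator except [cr (part k)], so its
    commutator with [bop] is the cofactor [crh k]. *)
Lemma an_part_bop k v T :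
  an (part k) (bop N A v) T = crh k v T + bop N A (an (part k) v) T.
Proof.
have -> : bop N A v = fun S => \sum_k 1 * cr (part k) (crh k v) S.
  by apply/funext => S; rewrite bop_crh; apply: eq_bigr => i _; rewrite mul1r.
rewrite an_sum bop_crh -(sum_delta k (fun i => crh i v T)) -big_split /=.
apply: eq_bigr => i _; rewrite mul1r; case: eqVneq => [<-|ki].
  rewrite an_cr_id; congr (_ + _); rewrite /cr.
  case: ifP => _; last by rewrite oppr0.
  rewrite -mulrN; congr (_ * _); rewrite /crh an_sum -sumrN.
  by apply: eq_bigr => l _; rewrite an_cr ?part_hole// mulrN opprK.
rewrite add0r an_cr ?part_eq// /cr; case: ifP => _; last by rewrite oppr0.
rewrite -mulrN; congr (_ * _); rewrite /crh an_sum -sumrN.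
by apply: eq_bigr => l _; rewrite an_cr ?part_hole// mulrN opprK.
Qed.

Lemma bop_crp v T : bop N A v T = \sum_l cr (hole l) (crp l v) T.
Proof.
rewrite /bop exchange_big; apply: eq_bigr => l _; rewrite cr_sum.
by apply: eq_bigr => k _; rewrite crC mulrN mulNr.
Qed.

Lemma an_hole_bop l v T :
  an (hole l) (bop N A v) T = crp l v T + bop N A (an (hole l) v) T.
Proof.
have -> : bop N A v = fun S => \sum_l 1 * cr (hole l) (crp l v) S.
  by apply/funext => S; rewrite bop_crp; apply: eq_bigr => i _; rewrite mul1r.
rewrite an_sum bop_crp -(sum_delta l (fun i => crp i v T)) -big_split /=.
apply: eq_bigr => i _; rewrite mul1r; case: eqVneq => [<-|ki].
  rewrite an_cr_id; congr (_ + _); rewrite /cr.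
  case: ifP => _; last by rewrite oppr0.
  rewrite -mulrN; congr (_ * _); rewrite /crp an_sum -sumrN.
  apply: eq_bigr => k _.
  by rewrite an_cr ?(eq_sym (hole l)) ?part_hole// mulrN opprK.
rewrite add0r an_cr ?hole_eq// /cr; case: ifP => _; last by rewrite oppr0.
rewrite -mulrN; congr (_ * _); rewrite /crp an_sum -sumrN.
apply: eq_bigr => k _.
by rewrite an_cr ?(eq_sym (hole l)) ?part_hole// mulrN opprK.
Qed.

Lemma cr_bop x v T : cr x (bop N A v) T = bop N A (cr x v) T.
Proof.
have -> : bop N A v = fun S => \sum_k 1 * cr (part k) (crh k v) S.
  by apply/funext => S; rewrite bop_crh; apply: eq_bigr => i _; rewrite mul1r.
rewrite cr_sum bop_crh; apply: eq_bigr => k _; rewrite mul1r crC.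
rewrite /cr; case: ifP => _; last by rewrite oppr0.
rewrite -mulrN; congr (_ * _); rewrite -/(cr x (crh k v) _) cr_sum -sumrN.
by apply: eq_bigr => l _; rewrite -mulrN crC opprK.
Qed.

Lemma bop_sum (I : finType) (a : I -> K) (F : I -> fock K n) T :
  bop N A (fun S => \sum_i a i * F i S) T = \sum_i a i * bop N A (F i) T.
Proof.
rewrite /bop; under [RHS]eq_bigr do rewrite big_distrr /=.
rewrite [RHS]exchange_big; apply: eq_bigr => k _.
under [RHS]eq_bigr do rewrite big_distrr /=.
rewrite [RHS]exchange_big; apply: eq_bigr => l _.
have -> : cr (hole l) (fun S => \sum_i a i * F i S) =
    fun S => \sum_i a i * cr (hole l) (F i) S.
  by apply/funext => S; rewrite cr_sum.
by rewrite cr_sum big_distrr; apply: eq_bigr => i _; rewrite mulrCA.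
Qed.

Lemma crh_bop k v T : crh k (bop N A v) T = bop N A (crh k v) T.
Proof. by rewrite bop_sum; apply: eq_bigr => l _; rewrite cr_bop. Qed.

Lemma crp_bop l v T : crp l (bop N A v) T = bop N A (crp l v) T.
Proof. by rewrite bop_sum; apply: eq_bigr => k _; rewrite cr_bop. Qed.

Definition pow t : fock K n := iter t (bop N A) (@vacuum K n).

(** The commutator Y of [an x] with [bop] commutes with [bop], and [an x] kills the vacuum: [an x]
    acts as a derivation on powers. *)
Lemma an_pow x (Y : fock K n -> fock K n) :
  (forall v T, an x (bop N A v) T = Y v T + bop N A (an x v) T) ->
  (forall v T, Y (bop N A v) T = bop N A (Y v) T) ->
  forall t T, an x (pow t) T = Y (pow t.-1) T *+ t.
Proof.
move=> an_bop Y_bop; elim=> [|t IHt] T; first exact: an_vac.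
rewrite an_bop mulrS; congr (_ + _).
(* The multiple by t is written as a sum of t equal terms, so that linearity of [bop] applies. *)
have -> : an x (pow t) = fun S => \sum_(i < t) 1 * Y (pow t.-1) S.
  by apply/funext => S; rewrite IHt sumr_const card_ord mul1r.
rewrite bop_sum sumr_const card_ord mul1r; case: t {IHt} => // t.
by rewrite -Y_bop.
Qed.

(** Each application of [bop] adds one particle and one hole. *)
Lemma pow_supp t T : (npart T != t) || (nhole T != t) -> pow t T = 0.
Proof.
elim: t T => [|t IHt] T tT.
  rewrite /pow /= /vacuum -/(vac n); case: (T =P vac n) => [TE|//]; move: tT.
  by rewrite TE npart_vac nhole_vac.
rewrite /pow iterS -/(pow t) /bop big1 // => k _; rewrite big1 // => l _.
rewrite /cr; case: ifP => [kT|]; last by rewrite mulr0.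
case: ifP => [lT|]; last by rewrite !mulr0.
rewrite IHt ?mulr0//; move: tT.
rewrite (npart_unflip kT) (nhole_unflip kT).
by rewrite (npart_unflip lT) (nhole_unflip lT) /= ?addn0 !addn1 !eqSS.
Qed.

End Bop.

(** * Linear relations that characterise a Bogoliubov transform *)

Lemma iter_bilinear_op N A t T : boxed N T ->
  iter t (bilinear_op A) (@vacuum K n) T = pow N A t T.
Proof.
elim: t T => //= t IHt T NT; rewrite (bilinear_opE _ _ NT).
apply: eq_bigr => k _; apply: eq_bigr => l _; congr (_ * _).
rewrite /cr; case: ifP => // _; case: ifP => // _.
by rewrite IHt//; do 2 apply: boxed_flip => //=.
Qed.

(** By [pow_supp], only the power equal to the number of particles survives in the exponential. *)
Lemma bogoliubovE N A T : boxed N T ->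
  bogoliubov A T = ((npart T)`!%:R^-1 : rat) *: pow N A (npart T) T.
Proof.
move=> NT; rewrite /bogoliubov (fsbigE [:: npart T])//=.
  by rewrite big_cons big_nil in_setT addr0 (iter_bilinear_op _ _ NT).
move=> t _; rewrite inE => tT.
rewrite (iter_bilinear_op _ _ NT) pow_supp ?scaler0//.
by rewrite eq_sym tT.
Qed.

Lemma bogoliubov_vac A : bogoliubov A (vac n) = 1.
Proof.
rewrite (bogoliubovE A (@boxed_vac n 0)) npart_vac.
by rewrite /pow /= /vacuum -/(vac n) eqxx fact0 invr1 scale1r.
Qed.

Lemma bogoliubov_charge A T : npart T != nhole T -> bogoliubov A T = 0.
Proof.
have [N NT] := boxed_exists T; move=> TT.
by rewrite (bogoliubovE A NT) pow_supp ?scaler0// eqxx eq_sym TT.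
Qed.

Lemma fact_scale t (z : K) :
  (t.+1`!%:R^-1 : rat) *: (z *+ t.+1) = (t`!%:R^-1 : rat) *: z.
Proof.
rewrite -scaler_nat scalerA factS natrM invfM mulrAC mulVf ?mul1r//.
by rewrite pnatr_eq0.
Qed.

(** The derivation rule of [an_pow] multiplies by t + 1, which turns 1/(t+1)! into 1/t!: the usual
    derivative of an exponential. *)
Lemma an_part_bogoliubov N A T (k : 'I_n * 'I_N) : boxed N T ->
  an (part k) (bogoliubov A) T =
  \sum_(l : 'I_n * 'I_N) A k.1 l.1 k.2 l.2 * cr (hole l) (bogoliubov A) T.
Proof.
move=> NT; set t := npart T.
(* The coefficient is read at T with the particle k added, hence the factorial of t + 1. *)
have -> : an (part k) (bogoliubov A) T =
    (t.+1`!%:R^-1 : rat) *: an (part k) (pow N A t.+1) T.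
  rewrite /an; case: ifP => [|/negbT kT]; first by rewrite scaler0.
  rewrite (@bogoliubovE N); last by [apply: boxed_part|apply: boxed_hole].
  by rewrite (npart_flip kT) addn1 scalerAr.
rewrite (an_pow (an_part_bop A k) (crh_bop A k)) fact_scale /= /crh scaler_sumr.
apply: eq_bigr => l _; rewrite scalerAr; congr (_ * _).
rewrite /cr; case: ifP => [lT|]; last by rewrite scaler0.
rewrite (@bogoliubovE N); last by [apply: boxed_part|apply: boxed_hole].
by rewrite /t (npart_unflip lT) addn0 scalerAr.
Qed.

Lemma an_hole_bogoliubov N A T (l : 'I_n * 'I_N) : boxed N T ->
  an (hole l) (bogoliubov A) T =
  \sum_(k : 'I_n * 'I_N) - A k.1 l.1 k.2 l.2 * cr (part k) (bogoliubov A) T.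
Proof.
move=> NT; set t := npart T.
have -> : an (hole l) (bogoliubov A) T =
    (t`!%:R^-1 : rat) *: an (hole l) (pow N A t) T.
  rewrite /an; case: ifP => [|/negbT lT]; first by rewrite scaler0.
  rewrite (@bogoliubovE N); last by [apply: boxed_part|apply: boxed_hole].
  by rewrite (npart_flip lT) addn0 scalerAr.
rewrite (an_pow (an_hole_bop A l) (crp_bop A l)).
(* Adding a hole keeps the number t of particles. For t = 0 there is no particle to remove, and both
   sides vanish. *)
case Et: t => [|t'].
  rewrite mulr0n scaler0 big1 // => k _; rewrite /cr.
  case: ifP => [kT|]; last by rewrite mulr0.
  by move: Et; rewrite /t (npart_unflip kT) addn1.
rewrite fact_scale /= /crp scaler_sumr.
apply: eq_bigr => k _; rewrite scalerAr; congr (_ * _).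
rewrite /cr; case: ifP => [kT|]; last by rewrite scaler0.
rewrite (@bogoliubovE N); last by [apply: boxed_part|apply: boxed_hole].
by move: Et; rewrite /t (npart_unflip kT) addn1 => -[->]; rewrite scalerAr.
Qed.

(* Repeatedly removing particles by the hypothesis reduces every coefficient
   of [v] to its vacuum coefficient. *)
Lemma bogoliubov_unique A v :
  v (vac n) = 1 -> (forall T, npart T != nhole T -> v T = 0) ->
  (forall N T (k : 'I_n * 'I_N), boxed N T -> an (part k) v T =
    \sum_(l : 'I_n * 'I_N) A k.1 l.1 k.2 l.2 * cr (hole l) v T) ->
  v = bogoliubov A.
Proof.
move=> v1 v0 vA; apply/funext => T.
have [t] := ubnP (npart T); elim: t T => // t IHt T tT.
case: (eqVneq (npart T) (nhole T)) => [ph|ph]; last first.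
  by rewrite v0// bogoliubov_charge.
have [->|[x xT]] := vacP T; first by rewrite bogoliubov_vac.
(* A neutral state other than the vacuum contains a particle: an excitation that is a hole forces a
   particle by charge 0. *)
have [y [yT y0]] : exists y, exc y T /\ 0 <= y.2.
  have [x0|x0] := leP 0 x.2; first by exists x.
  case: (pselect (exists y, exc y T /\ 0 <= y.2)) => // H; exfalso.
  have : nhole T != 0%N by rewrite (nhole_unflip xT) x0 addn1.
  rewrite -ph => /negP; apply; rewrite /npart sum_nat_eq0; apply/forallP => i /=.
  apply/eqP/eqP; rewrite cardfs_eq0; apply/eqP/fsetP => r.
  rewrite in_fset_set ?in_fset0; last exact: finite_particles.
  rewrite in_setD in_negatives -leNgt; apply/negbTE/negP => /andP[rT r0].
  by apply: H; exists (i, r); rewrite /exc /excited /= rT ltNge r0.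
case: y yT y0 => i [m|//] yT _.
have [N NT] := boxed_exists T; have mN : (m < N)%N := NT _ yT.
pose k : 'I_n * 'I_N := (i, Ordinal mN).
have yE : (i, Posz m) = part k by [].
rewrite yE in yT; have kT := flip_unexc yT.
have main w : w T = sg K (part k) T * an (part k) w (flip (part k) T).
  by rewrite /an (negPf kT) flipK sg_flip_id mulrA sg_sqr mul1r.
have NT' : boxed N (flip (part k) T) by exact: boxed_part.
rewrite (main v) (main (bogoliubov A)) vA// an_part_bogoliubov//; congr (_ * _).
apply: eq_bigr => l _; congr (_ * _); rewrite /cr; case: ifP => // lT.
(* The state has lost the particle k and the hole l, so it has fewer particles than T. *)
rewrite IHt //; move: tT; rewrite (npart_unflip yT) (npart_unflip lT) /=; lia.
Qed.

End Exponential.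

(** * Pairing over the last two factors *)

Section Join.
Local Open Scope ring_scope.
Variable n : nat.
Implicit Types (S : state n) (T : state 2) (x : 'I_n * int) (y : 'I_2 * int).

Definition lsite x : 'I_(n + 2) * int := (lshift 2 x.1, x.2).
Definition rsite y : 'I_(n + 2) * int := (rshift n y.1, y.2).

Lemma join_lshift S T i : join_state S T (lshift 2 i) = S i.
Proof. by rewrite ffunE (unsplitK (inl i)). Qed.

Lemma join_rshift S T i : join_state S T (rshift n i) = T i.
Proof. by rewrite ffunE (unsplitK (inr i)). Qed.

Lemma exc_lsite x S T : exc (lsite x) (join_state S T) = exc x S.
Proof. by rewrite /exc /= join_lshift. Qed.

Lemma exc_rsite y S T : exc (rsite y) (join_state S T) = exc y T.
Proof. by rewrite /exc /= join_rshift. Qed.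

Lemma join_eq (U U' : state (n + 2)) :
  (forall i, U (lshift 2 i) = U' (lshift 2 i)) ->
  (forall i, U (rshift n i) = U' (rshift n i)) -> U = U'.
Proof. by move=> Ul Ur; apply/ffunP => i; case: (split_ordP i) => j ->. Qed.

Lemma flip_lsite x S T :
  flip (lsite x) (join_state S T) = join_state (flip x S) T.
Proof.
apply: join_eq => i; rewrite ffunE !(join_lshift, join_rshift) /=.
  by rewrite eq_lshift ffunE.
by rewrite eq_rlshift.
Qed.

Lemma flip_rsite y S T :
  flip (rsite y) (join_state S T) = join_state S (flip y T).
Proof.
apply: join_eq => i; rewrite ffunE !(join_lshift, join_rshift) /=.
  by rewrite eq_lrshift.
by rewrite eq_rshift ffunE.
Qed.

Lemma sgn_lsite x S T : sgn (lsite x) (join_state S T) = sgn x S.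
Proof.
rewrite /sgn /koszul big_split_ord /= join_lshift; congr (odd (_ + _)).
rewrite [X in (_ + X)%N]big1 ?addn0; last by move=> j; have := ltn_ord x.1; lia.
by apply: eq_bigr => j _; rewrite join_lshift.
Qed.

Definition state_parity S : bool := odd (\sum_j parity (S j))%N.

(** An operator on a or b passes all n external factors and picks up the total parity of S. *)
Lemma sgn_rsite y S T :
  sgn (rsite y) (join_state S T) = state_parity S (+) sgn y T.
Proof.
rewrite /sgn /koszul big_split_ord /= join_rshift /state_parity -oddD addnA.
congr (odd (_ + _ + _)).
  apply: eq_big => [j|j _]; last by rewrite join_lshift.
  by have := ltn_ord j; lia.
by apply: eq_big => [j|j _]; rewrite ?join_rshift// ltn_add2l.
Qed.

Lemma join_vac : join_state (vac n) (vac 2) = vac (n + 2).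
Proof. by apply: join_eq => i; rewrite !(join_lshift, join_rshift) !ffunE. Qed.

Lemma npart_join S T : npart (join_state S T) = (npart S + npart T)%N.
Proof.
by rewrite /npart big_split_ord; congr (_ + _)%N; apply: eq_bigr => i _;
  rewrite !(join_lshift, join_rshift).
Qed.

Lemma nhole_join S T : nhole (join_state S T) = (nhole S + nhole T)%N.
Proof.
by rewrite /nhole big_split_ord; congr (_ + _)%N; apply: eq_bigr => i _;
  rewrite !(join_lshift, join_rshift).
Qed.

Lemma boxed_join N S T : boxed N S -> boxed N T -> boxed N (join_state S T).
Proof.
move=> NS NT [i r]; case: (split_ordP i) => j ->.
  by rewrite (exc_lsite (j, r)) => /NS.
by rewrite (exc_rsite (j, r)) => /NT.
Qed.

End Join.

Lemma sum_pair_split (K : nmodType) n m N (F : 'I_(n + m) * 'I_N -> K) :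
  (\sum_l F l = \sum_(l : 'I_n * 'I_N) F (lshift m l.1, l.2) +
               \sum_(l : 'I_m * 'I_N) F (rshift n l.1, l.2))%R.
Proof.
rewrite (eq_bigr (fun l => F (l.1, l.2))); last by case.
rewrite -(pair_bigA _ (fun i b => F (i, b))) big_split_ord /=.
by rewrite !pair_bigA.
Qed.

(** * Truncated pairing and the quadratic relations of its coefficients *)

Section Pairing.
Local Open Scope ring_scope.
Variables (K : comAlgType rat) (n N : nat).
Implicit Types (S : state n) (T : state 2) (x : 'I_n * int) (y : 'I_2 * int).
Implicit Types (v : fock K (n + 2)) (w : fock K 2).

(** A finite version of [partial_inner], restricted to the states of the box. *)
Definition pairing v w : fock K n :=
  fun S => \sum_(T <- box 2 N) v (join_state S T) * w T.

Lemma cr_pairing x v w S : cr x (pairing v w) S = pairing (cr (lsite x) v) w S.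
Proof.
rewrite /cr /pairing; case: ifP => xS.
  rewrite big_distrr /=; apply: eq_bigr => T _.
  by rewrite exc_lsite xS mulrA /sg sgn_lsite flip_lsite.
by rewrite big1 // => T _; rewrite exc_lsite xS mul0r.
Qed.

Lemma an_pairing x v w S : an x (pairing v w) S = pairing (an (lsite x) v) w S.
Proof.
rewrite /an /pairing; case: ifP => xS.
  by rewrite big1 // => T _; rewrite exc_lsite xS mul0r.
rewrite big_distrr /=; apply: eq_bigr => T _.
by rewrite exc_lsite xS mulrA /sg sgn_lsite flip_lsite.
Qed.

(** Since [flip y] permutes the box, reindexing moves the operator from v to w; the sign comes from
    passing S. *)
Lemma cr_adjoint y v w S : (idx y.2 < N)%N ->
  pairing (cr (rsite n y) v) w S = (-1) ^+ state_parity S * pairing v (an y w) S.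
Proof.
move=> yN; rewrite /pairing -(perm_big _ (box_flip yN)) big_map big_distrr /=.
apply: eq_bigr => T _; rewrite /cr /an exc_rsite exc_flip eqxx addbT.
case: (exc y T) => /=; first by rewrite mul0r !mulr0.
rewrite flip_rsite flipK /sg sgn_rsite sgn_flip_id signr_addb -!mulrA.
by congr (_ * _); rewrite mulrCA.
Qed.

Lemma an_adjoint y v w S : (idx y.2 < N)%N ->
  pairing (an (rsite n y) v) w S = (-1) ^+ state_parity S * pairing v (cr y w) S.
Proof.
move=> yN; rewrite /pairing -(perm_big _ (box_flip yN)) big_map big_distrr /=.
apply: eq_bigr => T _; rewrite /cr /an exc_rsite exc_flip eqxx addbT.
case: (exc y T) => /=; last by rewrite mul0r !mulr0.
rewrite flip_rsite flipK /sg sgn_rsite sgn_flip_id signr_addb -!mulrA.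
by congr (_ * _); rewrite mulrCA.
Qed.

Variables (A : coefs K (n + 2)) (B : coefs K 2).
Let v := bogoliubov A.
Let w := bogoliubov B.
Let g := pairing v w.

Let inner_part (k : 'I_2 * 'I_N) := pairing (an (rsite n (part k)) v) w.
Let inner_hole (l : 'I_2 * 'I_N) := pairing (cr (rsite n (hole l)) v) w.

Let part_relation (k : 'I_(n + 2) * 'I_N) S : boxed N S ->
  pairing (an (part k) v) w S =
  \sum_(l : 'I_n * 'I_N) A k.1 (lshift 2 l.1) k.2 l.2 * cr (hole l) g S +
  \sum_(l : 'I_2 * 'I_N) A k.1 (rshift n l.1) k.2 l.2 * inner_hole l S.
Proof.
move=> NS.
transitivity (\sum_(l : 'I_(n + 2) * 'I_N)
    A k.1 l.1 k.2 l.2 * pairing (cr (hole l) v) w S).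
  under [RHS]eq_bigr do rewrite big_distrr /=.
  rewrite exchange_big /pairing; apply: eq_big_seq => T /boxP NT.
  rewrite an_part_bogoliubov; last exact: boxed_join.
  by rewrite big_distrl /=; apply: eq_bigr => l _; rewrite mulrA.
rewrite sum_pair_split; congr (_ + _); apply: eq_bigr => l _ //.
by rewrite cr_pairing.
Qed.

(** The operator is moved to w by adjunction, expanded by the linear relation of w, and moved back;
    the two parity signs cancel. *)
Let hole_relation (l : 'I_2 * 'I_N) S :
  inner_hole l S = \sum_(k : 'I_2 * 'I_N) - B k.1 l.1 k.2 l.2 * inner_part k S.
Proof.
rewrite /inner_hole cr_adjoint; last exact: ltn_ord.
under [RHS]eq_bigr => k _ do rewrite /inner_part an_adjoint ?ltn_ord// mulrCA.
rewrite -big_distrr /=; congr (_ * _).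
under [RHS]eq_bigr do rewrite big_distrr /=.
rewrite exchange_big /pairing; apply: eq_big_seq => T /boxP NT.
rewrite an_hole_bogoliubov// big_distrr /=; apply: eq_bigr => k _.
by rewrite mulrCA.
Qed.

(** The homogeneous internal system has only the zero solution; divisibility of B by Q will ensure
    this. *)
Hypothesis contraction : forall u : 'I_2 * 'I_N -> K,
  (forall l, u l = \sum_(k : 'I_2 * 'I_N) - B k.1 l.1 k.2 l.2 *
    \sum_(l' : 'I_2 * 'I_N) A (rshift n k.1) (rshift n l'.1) k.2 l'.2 * u l') ->
  forall l, u l = 0.

(* The combination [D f] of values of [f] kills [cr (hole l) g] for every
   external hole, so by the linear relations [D (inner_hole l)] is a solution
   of a homogeneous contracting system, hence 0; thus [D] kills [an (part k) g]. *)
Lemma pairing_plucker (k : 'I_n * 'I_N) S : boxed N S ->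
  g (vac n) * an (part k) g S =
  \sum_(l : 'I_n * 'I_N) cr (hole l) g S *
    (sg K (hole l) (vac n) * an (part k) g (flip (hole l) (vac n))).
Proof.
move=> NS.
(* The factor [g (vac n)] keeps the relation free of division. *)
pose D (f : fock K n) := g (vac n) * f S -
  \sum_(l : 'I_n * 'I_N) cr (hole l) g S *
    (sg K (hole l) (vac n) * f (flip (hole l) (vac n))).
suff : D (an (part k) g) = 0 by move/eqP; rewrite subr_eq0 => /eqP.
have Nflip (l : 'I_n * 'I_N) : boxed N (flip (hole l) (vac n)).
  exact/boxed_hole/boxed_vac.
(* D evaluates f only at S and at one-hole states, all of which are boxed. *)
have Deq f f' : (forall U, boxed N U -> f U = f' U) -> D f = D f'.
  move=> ff'; rewrite /D ff'//; congr (_ - _).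
  by apply: eq_bigr => l _; rewrite ff'.
have Dsum (I : finType) (a : I -> K) (f : I -> fock K n) :
    D (fun U => \sum_i a i * f i U) = \sum_i a i * D (f i).
  rewrite /D; under [RHS]eq_bigr do rewrite mulrBr; rewrite sumrB; congr (_ - _).
    by rewrite big_distrr /=; apply: eq_bigr => i _; rewrite mulrCA.
  under [RHS]eq_bigr do rewrite big_distrr /=.
  rewrite exchange_big; apply: eq_bigr => l _ /=.
  rewrite !big_distrr /=; apply: eq_bigr => i _.
  by rewrite ![_ * (a i * _)]mulrCA.
have Dadd f f' : D (fun U => f U + f' U) = D f + D f'.
  rewrite /D mulrDr -addrACA -opprD -big_split /=; congr (_ - _).
  by apply: eq_bigr => l _; rewrite !mulrDr.
(* At the one-hole state of l', [cr (hole l) g] vanishes unless l' = l, where it is [g (vac n)] up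
   to a sign that cancels. *)
have D0 (l : 'I_n * 'I_N) : D (cr (hole l) g) = 0.
  apply/eqP; rewrite /D subr_eq0 (bigD1 l)//=.
  rewrite [X in _ + X]big1 ?addr0 => [|l' ll'].
    rewrite /cr exc_flip eqxx exc_vac /= sg_flip_id flipK.
    by rewrite [sg _ _ _ * (_ * _)]mulrA sg_sqr mul1r mulrC.
  by rewrite /cr exc_flip exc_vac hole_eq eq_sym (negPf ll') !mulr0.
have Drel (k' : 'I_(n + 2) * 'I_N) : D (pairing (an (part k') v) w) =
    \sum_(l : 'I_2 * 'I_N) A k'.1 (rshift n l.1) k'.2 l.2 * D (inner_hole l).
  rewrite (Deq _ _ (part_relation k')) Dadd !Dsum.
  by rewrite [X in X + _]big1 ?add0r// => l _; rewrite D0 mulr0.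
have Dhole l : D (inner_hole l) = 0.
  apply: (@contraction (fun l => D (inner_hole l))) => {}l.
  rewrite (Deq _ _ (fun U _ => hole_relation l U)) Dsum.
  by apply: eq_bigr => k' _; congr (_ * _); exact: (Drel (rshift n k'.1, k'.2)).
rewrite (Deq _ (pairing (an (lsite (part k)) v) w)); last first.
  by move=> U _; exact: an_pairing.
rewrite (Drel (lshift 2 k.1, k.2)) big1 // => l _.
by rewrite Dhole mulr0.
Qed.

End Pairing.

(** * Q-adic limit and normalized gluing *)

Section Adic.
Local Open Scope ring_scope.
Variable L : comNzRingType.
Implicit Types (f g h : fps L) (t : nat).

Definition dvdQ t f : Prop := forall k, (k < t)%N -> fps_coef f k = 0.

Lemma dvdQ_leq s t f : (s <= t)%N -> dvdQ t f -> dvdQ s f.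
Proof. by move=> st ft k /leq_trans /(_ st) /ft. Qed.

Lemma dvdQ_eq0 f : (forall t, dvdQ t f) -> f = 0.
Proof. by move=> f0; apply: fpsP => k; rewrite (f0 k.+1). Qed.

Lemma dvdQ_add t f g : dvdQ t f -> dvdQ t g -> dvdQ t (f + g).
Proof. by move=> ft gt k kt /=; rewrite ft// gt// addr0. Qed.

Lemma dvdQ_opp t f : dvdQ t f -> dvdQ t (- f).
Proof. by move=> ft k kt /=; rewrite ft// oppr0. Qed.

Lemma dvdQ_sum t (I : Type) (r : seq I) (P : pred I) (F : I -> fps L) :
  (forall i, P i -> dvdQ t (F i)) -> dvdQ t (\sum_(i <- r | P i) F i).
Proof. by move=> Ft; apply: big_ind => //; exact: dvdQ_add. Qed.

Lemma dvdQ_mul s t f g : dvdQ s f -> dvdQ t g -> dvdQ (s + t) (f * g).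
Proof.
move=> fs gt k kst; rewrite fps_coefM big1 // => i _.
case: (ltnP i s) => [/fs ->|si]; first by rewrite mul0r.
by rewrite gt ?mulr0//; have := ltn_ord i; lia.
Qed.

Lemma dvdQ_mull t f g : dvdQ t g -> dvdQ t (f * g).
Proof. exact: (@dvdQ_mul 0). Qed.

Lemma dvdQ_mulr t f g : dvdQ t f -> dvdQ t (f * g).
Proof. by rewrite mulrC; exact: dvdQ_mull. Qed.

Definition eqmodQ t f g : Prop := dvdQ t (f - g).

Lemma eqmodQ_refl t f : eqmodQ t f f.
Proof. by rewrite /eqmodQ subrr. Qed.

Lemma eqmodQ_sub t f f' g g' :
  eqmodQ t f f' -> eqmodQ t g g' -> eqmodQ t (f - g) (f' - g').
Proof.
move=> ff' gg'; rewrite /eqmodQ opprD addrACA -opprD.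
by apply: dvdQ_add => //; exact: dvdQ_opp.
Qed.

Lemma eqmodQ_mul t f f' g g' :
  eqmodQ t f f' -> eqmodQ t g g' -> eqmodQ t (f * g) (f' * g').
Proof.
move=> ff' gg'; rewrite /eqmodQ.
have -> : f * g - f' * g' = (f - f') * g + f' * (g - g').
  by rewrite mulrBl mulrBr addrA subrK.
by apply: dvdQ_add; [exact: dvdQ_mulr|exact: dvdQ_mull].
Qed.

Lemma eqmodQ_sum t (I : Type) (r : seq I) (P : pred I) (F G : I -> fps L) :
  (forall i, eqmodQ t (F i) (G i)) ->
  eqmodQ t (\sum_(i <- r | P i) F i) (\sum_(i <- r | P i) G i).
Proof.
by move=> FG; rewrite /eqmodQ -sumrB; apply: dvdQ_sum => i _; exact: FG.
Qed.

Lemma fps_coef_sum (I : Type) (r : seq I) (P : pred I) (F : I -> fps L) k :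
  fps_coef (\sum_(i <- r | P i) F i) k = \sum_(i <- r | P i) fps_coef (F i) k.
Proof. exact: (big_morph (fun f => fps_coef f k)). Qed.

(** Each substitution of the system into itself gains a factor Q, so u is divisible by every power
    of Q. *)
Lemma contracting_system (I J : finType)
    (a : J -> I -> fps L) (b : I -> J -> fps L)
    (u : I -> fps L) :
  (forall i j, dvdQ 1 (b i j)) ->
  (forall i, u i = \sum_j b i j * \sum_i' a j i' * u i') -> forall i, u i = 0.
Proof.
move=> b1 ub i; apply: dvdQ_eq0 => t; elim: t i => // t IHt i.
rewrite ub; apply: dvdQ_sum => j _; apply: (@dvdQ_mul 1) => //.
by apply: dvdQ_sum => i' _; exact: dvdQ_mull.
Qed.

End Adic.

Lemma sum_pair_widen (K : nmodType) n N N' (F : 'I_n -> nat -> K) : (N <= N')%N ->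
  (forall j b, (N <= b)%N -> F j b = 0)%R ->
  (\sum_(l : 'I_n * 'I_N') F l.1 l.2 = \sum_(l : 'I_n * 'I_N) F l.1 l.2)%R.
Proof.
move=> NN' F0; rewrite -(pair_bigA _ (fun j (b : 'I_N') => F j b)).
rewrite -(pair_bigA _ (fun j (b : 'I_N) => F j b)) /=; apply: eq_bigr => j _.
rewrite (big_ord_widen _ (F j) NN') [RHS]big_mkcond; apply: eq_bigr => b _.
by case: ltnP => // /F0.
Qed.

(** * The gluing as a Q-adic limit of truncated pairings *)

Section Gluing.
Local Open Scope ring_scope.
Variables (R : comAlgType rat) (n : nat).
Variables (A : coefs (series R) (n + 2)) (B : coefs (series R) 2).
Hypothesis BQ : forall i j m b, dvdQ (m + b + 1) (B i j m b).
Implicit Types (S : state n) (T : state 2).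
Let v := bogoliubov A.
Let w := bogoliubov B.

(** Removing x by the linear relation of w produces an entry of B with the mode of x among its
    indices. *)
Lemma dvdQ_gluing_vector x T : exc x T -> dvdQ (idx x.2).+1 (w T).
Proof.
move=> xT; have [N NT] := boxed_exists T.
have wE : w T = sg _ x T * an x w (flip x T).
  by rewrite /an (negPf (flip_unexc xT)) sg_flip_id flipK mulrA sg_sqr mul1r.
rewrite wE; apply: dvdQ_mull; have xN := NT _ xT.
have NT' := boxed_flip xN NT.
case: x xT xN NT' {wE} => i [m|b] /= _ xN NT'.
  rewrite (@an_part_bogoliubov _ _ _ _ _ (i, Ordinal xN) NT').
  apply: dvdQ_sum => l _; apply: dvdQ_mulr.
  apply: dvdQ_leq _ (@BQ _ _ _ _) => /=; lia.
rewrite (@an_hole_bogoliubov _ _ _ _ _ (i, Ordinal xN) NT').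
apply: dvdQ_sum => l _; apply/dvdQ_mulr/dvdQ_opp.
apply: dvdQ_leq _ (@BQ _ _ _ _) => /=; lia.
Qed.

(** A state outside the box has an excitation of mode at least N, so its coefficient in w does not
    affect degrees below N. *)
Lemma inner_boxed N (f : fock (series R) 2) :
  eqmodQ N (inner f w) (\sum_(T <- box 2 N) f T * w T).
Proof.
move=> k kN /=; rewrite fps_coef_sum (fsbigE (box 2 N)) ?box_uniq//; last first.
  move=> T _ TN.
  have [x xT Nx] : exists2 x, exc x T & (N <= idx x.2)%N.
    case: (pselect (exists2 x, exc x T & (N <= idx x.2)%N)) => // H.
    case/boxP: TN => x xT; rewrite ltnNge; apply/negP => Nx.
    by apply: H; exists x.
  have := @dvdQ_mull _ _ (f T) _ (dvdQ_gluing_vector xT); apply; lia.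
by rewrite (eq_bigl predT) ?subrr// => T; rewrite in_setT.
Qed.

Let G := partial_inner v w.

Let G_pairing N S : eqmodQ N (G S) (pairing N v w S).
Proof. exact: inner_boxed. Qed.

Let an_G_pairing N x S : eqmodQ N (an x G S) (an x (pairing N v w) S).
Proof.
rewrite /an; case: ifP => _; first exact: eqmodQ_refl.
by apply: eqmodQ_mul; [exact: eqmodQ_refl|exact: G_pairing].
Qed.

Let cr_G_pairing N x S : eqmodQ N (cr x G S) (cr x (pairing N v w) S).
Proof.
rewrite /cr; case: ifP => _; last exact: eqmodQ_refl.
by apply: eqmodQ_mul; [exact: eqmodQ_refl|exact: G_pairing].
Qed.

Lemma gluing_plucker N (k : 'I_n * 'I_N) S : boxed N S ->
  G (vac n) * an (part k) G S =
  \sum_(l : 'I_n * 'I_N) cr (hole l) G S *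
    (sg _ (hole l) (vac n) * an (part k) G (flip (hole l) (vac n))).
Proof.
move=> NS; apply/eqP; rewrite -subr_eq0; apply/eqP/dvdQ_eq0 => t.
(* The box must contain S and also be exact modulo Q^t. *)
pose N' := maxn N t; have NN' : (N <= N')%N := leq_maxl _ _.
pose defect (f : fock (series R) n) := f (vac n) * an (part k) f S -
  \sum_(l : 'I_n * 'I_N) cr (hole l) f S *
    (sg _ (hole l) (vac n) * an (part k) f (flip (hole l) (vac n))).
have GN : eqmodQ N' (defect G) (defect (pairing N' v w)).
  apply: eqmodQ_sub.
    by apply: eqmodQ_mul; [exact: G_pairing|exact: an_G_pairing].
  apply: eqmodQ_sum => l; apply: eqmodQ_mul; first exact: cr_G_pairing.
  by apply: eqmodQ_mul; [exact: eqmodQ_refl|exact: an_G_pairing].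
suff p0 : defect (pairing N' v w) = 0.
  by move: GN; rewrite p0 /eqmodQ subr0; apply: dvdQ_leq; exact: leq_maxr.
apply/eqP; rewrite subr_eq0; apply/eqP.
have -> : part k = part (k.1, widen_ord NN' k.2) by [].
rewrite pairing_plucker; last exact: boxed_leq NS.
  set h := an _ _; pose F j b := cr (j, Negz b) (pairing N' v w) S *
    (sg _ (j, Negz b) (vac n) * h (flip (j, Negz b) (vac n))).
  apply: (sum_pair_widen (F := F)) => // j b Nb.
  (* S has no hole of mode N or more, so widening the box adds only zero terms. *)
  rewrite /F /cr; case: ifP => [/NS /=|]; last by rewrite mul0r.
  by rewrite ltnNge Nb.
move=> u uE; apply: contracting_system uE => l k'.
by apply/dvdQ_opp/(dvdQ_leq _ (@BQ _ _ _ _)); lia.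
Qed.

(** Neutrality of w forces T to be neutral, and then neutrality of v forces S to be. *)
Lemma gluing_charge S : npart S != nhole S -> G S = 0.
Proof.
move=> SS; apply: fpsP => k /=; rewrite fsbig1 // => T _.
suff vw0 : v (join_state S T) * w T = 0.
  exact: (congr1 (fun f => fps_coef f k) vw0).
case: (eqVneq (npart T) (nhole T)) => TT; last first.
  by rewrite /w bogoliubov_charge ?mulr0.
by rewrite /v bogoliubov_charge ?mul0r// npart_join nhole_join TT eqn_add2r.
Qed.

Lemma state_parity_vac : state_parity (vac n) = false.
Proof.
rewrite /state_parity big1 // => i _; rewrite ffunE /parity /= setDv.
by rewrite fset_set0 cardfs0.
Qed.

(** With the external factors in the vacuum no external hole can be removed, so only the internal
    block of A remains in the linear relations; uniqueness concludes. *)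
Lemma bogoliubov_join_vac :
  (fun T => v (join_state (vac n) T)) =
  bogoliubov (fun i j => A (rshift n i) (rshift n j)).
Proof.
apply: bogoliubov_unique.
- by rewrite join_vac /v bogoliubov_vac.
- move=> T TT; rewrite /v bogoliubov_charge// npart_join nhole_join.
  by rewrite npart_vac nhole_vac.
move=> N T k NT; set v' := fun T => _.
have anE y : an y v' T = an (rsite n y) v (join_state (vac n) T).
  by rewrite /an exc_rsite flip_rsite /sg sgn_rsite state_parity_vac.
have crE y : cr y v' T = cr (rsite n y) v (join_state (vac n) T).
  by rewrite /cr exc_rsite flip_rsite /sg sgn_rsite state_parity_vac.
rewrite anE (@an_part_bogoliubov _ _ N _ _ (rshift n k.1, k.2)); last first.
  by apply: boxed_join => //; exact: boxed_vac.
rewrite sum_pair_split [X in X + _]big1 ?add0r => [|l _].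
  by apply: eq_bigr => l _; rewrite crE.
by rewrite /cr (exc_lsite (hole l)) exc_vac mulr0.
Qed.

(** Every T other than the vacuum contributes a multiple of Q. Hence division by [G (vac n)] is
    genuine. *)
Lemma gluing_vac0 : fps_coef (G (vac n)) 0 = 1.
Proof.
rewrite /= (fsbigE [:: vac 2])//=; last first.
  move=> T _; rewrite inE => Tv.
  have [TE|[x xT]] := vacP T; first by rewrite TE eqxx in Tv.
  have := @dvdQ_mull _ _ (v (join_state (vac n) T)) _ (dvdQ_gluing_vector xT).
  exact.
rewrite big_cons big_nil in_setT addr0 join_vac /v /w !bogoliubov_vac.
exact: (congr1 (fun f => fps_coef f 0) (mulr1 (1 : series R))).
Qed.

Lemma normalized_bogoliubov :
  exists C, (fun S => G S / G (vac n)) = bogoliubov C.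
Proof.
set c := G (vac n).
have cU : c \is a GRing.unit by apply/fps_unit_coef0/gluing_vac0.
set g := fun S => _.
have anE x S : an x g S = an x G S * c^-1.
  by rewrite /an; case: ifP => _; rewrite ?mul0r// mulrA.
have crE x S : cr x g S = cr x G S * c^-1.
  by rewrite /cr; case: ifP => _; rewrite ?mul0r// mulrA.
(* These coefficients are forced: they are obtained by evaluating the linear relation at the state
   with the single hole (j, b). *)
exists (fun i j m b => sg _ (j, Negz b) (vac n) *
  an (i, Posz m) g (flip (j, Negz b) (vac n))).
apply: bogoliubov_unique => [|S SS|N S k NS]; first exact: divrr.
  by rewrite /g gluing_charge ?mul0r.
(* A factor c is inserted to apply the quadratic relation; the two inverses of c normalise its two
   occurrences of G. *)
rewrite anE -[an _ _ _](mulKr cU) gluing_plucker// -mulrA mulrC big_distrl /=.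
rewrite big_distrl; apply: eq_bigr => l _ /=; rewrite anE crE.
by rewrite -[LHS]mulrA [sg _ _ _ * (_ / _)]mulrA [RHS]mulrACA [_ * cr _ _ _]mulrC.
Qed.

End Gluing.

Theorem theorem4p1 (R : comAlgType rat) (M N : nat) (hM : (0 < M)%N) (hN : (0 < N)%N)
  (A1 : coefs R (M + 1)) (A2 : coefs R (N + 1)) (E : coefs R 2) :
  exists C : coefs (series R) (M + N),
    normalized_gluing E A1 A2 = bogoliubov C.
Proof.
pose A := embed (tensor_coefs A1 A2).
pose B : coefs (series R) 2 :=
  fun i j m n => monomial (m + n + 1) (theta_exp i j) (E i j m n).
have BQ i j m b : dvdQ (m + b + 1) (B i j m b).
  by move=> k km /=; rewrite ltn_eqF.
have [C GC] := normalized_bogoliubov A BQ; exists C; rewrite -GC.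
rewrite /normalized_gluing; apply/funext => S; congr (_ / _)%R.
(* The closed part is the vacuum coefficient of the gluing. *)
by rewrite /gluing_closed /partial_inner bogoliubov_join_vac.
Qed.
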